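(* Let $K$ be an infinite field, $S=K[x_1,\dots,x_m,y_1,\dots,y_n]$ the standard bigraded polynomial ring and $Q=(y_1,\dots,y_n)$. Let $M$ be a finitely generated bigraded $S$-module which is relative Cohen--Macaulay with respect to $Q$ with $\operatorname{rdim}(Q,M)>0$. Then there exists a bihomogeneous $M$-regular element $z\in Q$ such that $M/zM$ is relative Cohen--Macaulay with respect to $Q$ and $$\operatorname{rdim}(Q,M/zM)=\operatorname{rdim}(Q,M)-1.$$
   Context: $S$ is bigraded by $\deg x_i=(1,0)$ and $\deg y_j=(0,1)$. A nonzero finitely generated bigraded $S$-module $M$ is called relative Cohen--Macaulay with respect to $Q$ if there is an integer $q$ with $H^i_Q(M)=0$ for all $i\neq q$ (equivalently, the smallest and the largest $i$ with $H^i_Q(M)\ne0$ coincide); this $q$ is denoted $\operatorname{rdim}(Q,M)$. *)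

(* Defs.v *)
From HB Require Import structures.
From mathcomp Require Import all_boot all_algebra.
From mathcomp Require Export mpoly.
From mathcomp Require Import zify.
From mathcomp Require Import boolp classical_sets cardinality.

Set Implicit Arguments.
Unset Strict Implicit.
Unset Printing Implicit Defensive.

Import GRing.Theory.
Local Open Scope ring_scope.
Local Open Scope quotient_scope.

Section Localization.
Variables (R : comNzRingType) (M : lmodType R) (f : R).

(* The pair (v, k) stands for the fraction v / f^k. *)
Definition loc_rel (a b : M * nat) : bool :=
  `[< exists t, f ^+ (t + b.2) *: a.1 = f ^+ (t + a.2) *: b.1 >].

Lemma loc_relP a b :
  reflect (exists t, f ^+ (t + b.2) *: a.1 = f ^+ (t + a.2) *: b.1)
          (loc_rel a b).
Proof. exact: asboolP. Qed.

Lemma loc_rel_refl : reflexive loc_rel.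
Proof. by move=> a; apply/loc_relP; exists 0%N. Qed.

Lemma loc_rel_sym : ssrbool.symmetric loc_rel.
Proof. by move=> a b; apply/loc_relP/loc_relP => -[t tE]; exists t. Qed.

Lemma loc_rel_trans : transitive loc_rel.
Proof.
move=> b a c /loc_relP[t abE] /loc_relP[u bcE].
apply/loc_relP; exists (t + u + b.2)%N.
have -> : (t + u + b.2 + c.2 = (u + c.2) + (t + b.2))%N.
  by lia.
have -> : (t + u + b.2 + a.2 = (t + a.2) + (u + b.2))%N.
  by lia.
by rewrite ![in LHS]exprD -scalerA -exprD -exprD abE scalerA mulrC -scalerA bcE
           scalerA -exprD.
Qed.

Canonical loc_equiv :=
  EquivRel loc_rel loc_rel_refl loc_rel_sym loc_rel_trans.

Definition loc := {eq_quot loc_rel}.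

HB.instance Definition _ : EqQuotient _ loc_rel loc := EqQuotient.on loc.
HB.instance Definition _ := Choice.on loc.

Definition frac (v : M) (k : nat) : loc := \pi_loc (v, k).

Lemma fracP v k w l :
  frac v k = frac w l <-> exists t, f ^+ (t + l) *: v = f ^+ (t + k) *: w.
Proof.
split=> [/eqmodP /loc_relP //|vw].
by apply/eqmodP/loc_relP.
Qed.

Lemma frac_repr x : frac (repr x).1 (repr x).2 = x.
Proof. by rewrite /frac -surjective_pairing reprK. Qed.

Lemma fracW x : exists v k, x = frac v k.
Proof. by exists (repr x).1, (repr x).2; rewrite frac_repr. Qed.

Definition loc_add (x y : loc) : loc :=
  let a := repr x in let b := repr y in
  frac (f ^+ b.2 *: a.1 + f ^+ a.2 *: b.1) (a.2 + b.2).
Definition loc_opp (x : loc) : loc := frac (- (repr x).1) (repr x).2.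
Definition loc_scale (r : R) (x : loc) : loc :=
  frac (r *: (repr x).1) (repr x).2.

Lemma loc_addE v k w l :
  loc_add (frac v k) (frac w l) = frac (f ^+ l *: v + f ^+ k *: w) (k + l).
Proof.
rewrite /loc_add; set a := repr (frac v k); set b := repr (frac w l).
have /fracP[t tE] : frac a.1 a.2 = frac v k by rewrite frac_repr.
have /fracP[u uE] : frac b.1 b.2 = frac w l by rewrite frac_repr.
apply/fracP; exists (t + u)%N; rewrite !scalerDr !scalerA -!exprD.
congr (_ + _).
  have -> : (t + u + (k + l) + b.2 = (u + l + b.2) + (t + k))%N.
    by lia.
  by rewrite exprD -scalerA tE scalerA -exprD; congr (_ ^+ _ *: _); lia.
have -> : (t + u + (k + l) + a.2 = (t + k + a.2) + (u + l))%N.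
  by lia.
by rewrite exprD -scalerA uE scalerA -exprD; congr (_ ^+ _ *: _); lia.
Qed.

Lemma loc_oppE v k : loc_opp (frac v k) = frac (- v) k.
Proof.
rewrite /loc_opp; set a := repr (frac v k).
have /fracP[t tE] : frac a.1 a.2 = frac v k by rewrite frac_repr.
by apply/fracP; exists t; rewrite !scalerN tE.
Qed.

Lemma loc_scaleE r v k : loc_scale r (frac v k) = frac (r *: v) k.
Proof.
rewrite /loc_scale; set a := repr (frac v k).
have /fracP[t tE] : frac a.1 a.2 = frac v k by rewrite frac_repr.
apply/fracP; exists t.
by rewrite scalerA mulrC -scalerA tE scalerA mulrC -scalerA.
Qed.

Lemma loc_addA : associative loc_add.
Proof.
move=> x y z; have [v [k ->]] := fracW x; have [w [l ->]] := fracW y.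
have [u [j ->]] := fracW z; rewrite !loc_addE addnA; congr (frac _ _).
rewrite !scalerDr !scalerA -!exprD addrA; congr (_ + _ + _).
  by rewrite addnC.
by rewrite addnC.
Qed.

Lemma loc_addC : commutative loc_add.
Proof.
move=> x y; have [v [k ->]] := fracW x; have [w [l ->]] := fracW y.
by rewrite !loc_addE addrC addnC.
Qed.

Lemma loc_add0 : left_id (frac 0 0) loc_add.
Proof.
move=> x; have [v [k ->]] := fracW x.
by rewrite loc_addE scaler0 add0r expr0 scale1r.
Qed.

Lemma loc_addN : left_inverse (frac 0 0) loc_opp loc_add.
Proof.
move=> x; have [v [k ->]] := fracW x; rewrite loc_oppE loc_addE scalerN addNr.
by apply/fracP; exists 0%N; rewrite !scaler0.
Qed.

HB.instance Definition _ :=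
  GRing.isZmodule.Build loc loc_addA loc_addC loc_add0 loc_addN.

Lemma loc_scaleA a b (x : loc) :
  loc_scale a (loc_scale b x) = loc_scale (a * b) x.
Proof. by have [v [k ->]] := fracW x; rewrite !loc_scaleE scalerA. Qed.

Lemma loc_scale1 : left_id 1 loc_scale.
Proof. by move=> x; have [v [k ->]] := fracW x; rewrite loc_scaleE scale1r. Qed.

Lemma loc_scaleDr : right_distributive loc_scale +%R.
Proof.
move=> a x y; have [v [k ->]] := fracW x; have [w [l ->]] := fracW y.
have addE : forall w1 k1 w2 k2, frac w1 k1 + frac w2 k2 =
    frac (f ^+ k2 *: w1 + f ^+ k1 *: w2) (k1 + k2) by exact: loc_addE.
rewrite addE !loc_scaleE addE; congr (frac _ _).
by rewrite scalerDr !scalerA ![a * _]mulrC.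
Qed.

Lemma loc_scaleDl (x : loc) : {morph loc_scale^~ x : a b / a + b}.
Proof.
move=> a b; have [v [k ->]] := fracW x; rewrite !loc_scaleE.
rewrite [RHS]loc_addE.
by apply/fracP; exists 0%N; rewrite !add0n -scalerDr -scalerDl exprD -scalerA.
Qed.

HB.instance Definition _ := GRing.Zmodule_isLmodule.Build R loc
  loc_scaleA loc_scale1 loc_scaleDr loc_scaleDl.

End Localization.

(* The map M_f -> M_h, v / f^k |-> (g^k v) / h^k. It is only meaningful when
   h = f * g, in which case it is the canonical map (see [loc_mapE]). *)
Definition loc_map (R : comNzRingType) (M : lmodType R) (f h g : R)
    (x : loc M f) : loc M h :=
  frac h (g ^+ (repr x).2 *: (repr x).1) (repr x).2.

Lemma loc_mapE (R : comNzRingType) (M : lmodType R) (f h g : R) (v : M) k :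
  h = f * g -> loc_map h g (frac f v k) = frac h (g ^+ k *: v) k.
Proof.
move=> ->; rewrite /loc_map; set a := repr (frac f v k).
have /fracP[t tE] : frac f a.1 a.2 = frac f v k by rewrite frac_repr.
apply/fracP; exists t; rewrite !exprMn !scalerA.
rewrite (ACl (1*(2*3))%AC) [in RHS](ACl (1*(2*3))%AC) /= -!exprD.
have -> : (t + k + a.2 = t + a.2 + k)%N by rewrite addnAC.
by rewrite mulrC -scalerA tE scalerA mulrC -scalerA scalerA mulrC.
Qed.

Section Cech.
Variables (R : comNzRingType) (M : lmodType R) (n : nat) (y : 'I_n -> R).

Definition yprod (s : {set 'I_n}) : R := \prod_(j in s) y j.

(* The direct sum of the M_(y_s) over all subsets s; the degree i part consists
   of the families supported on the subsets of cardinality i. *)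
Definition cech := forall s : {set 'I_n}, loc M (yprod s).

Definition cech_deg (i : nat) (c : cech) : Prop :=
  forall s : {set 'I_n}, #|s| <> i -> c s = 0.

Definition cech_d (c : cech) : cech := fun s =>
  \sum_(j in s) (-1) ^+ #|[set k in s | (k < j)%N]| *:
    loc_map (yprod s) (y j) (c (s :\ j)).

Definition cocycle (i : nat) (c : cech) : Prop :=
  cech_deg i c /\ forall s, cech_d c s = 0.

(* The shifted condition on b forces b = 0 when i = 0. *)
Definition coboundary (i : nat) (c : cech) : Prop :=
  exists2 b : cech, (forall s : {set 'I_n}, #|s|.+1 <> i -> b s = 0) &
    forall s, c s = cech_d b s.

(* Local cohomology is defined as Cech cohomology: for I generated by the y_j,
   H^i_I(M) is the quotient of the i-cocycles by the i-coboundaries, and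
   lc_zero i says that it vanishes. *)
Definition lc_zero (i : nat) : Prop :=
  forall c : cech, cocycle i c -> coboundary i c.

End Cech.

Section QuotientByElement.
Variables (R : comNzRingType) (M : lmodType R) (z : R).

Definition zmul : {pred M} := fun v => `[< exists w, v = z *: w >].

Lemma zmul_zmod_closed : zmod_closed zmul.
Proof.
split=> [|_ _ /asboolP[v ->] /asboolP[w ->]]; apply/asboolP.
  by exists 0; rewrite scaler0.
by exists (v - w); rewrite scalerBr.
Qed.

HB.instance Definition _ := GRing.isZmodClosed.Build M zmul zmul_zmod_closed.

Definition quotz : Type := Quotient.quot zmul.

HB.instance Definition _ := GRing.Zmodule.on quotz.

Definition to_quotz (v : M) : quotz := \pi_(Quotient.quot zmul) v.

Lemma to_quotzP v w : to_quotz v = to_quotz w <-> exists u, v - w = z *: u.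
Proof.
rewrite /to_quotz; split.
  by move/eqP; rewrite -Quotient.idealrBE => /asboolP.
by move=> vw; apply/eqP; rewrite -Quotient.idealrBE; apply/asboolP.
Qed.

Lemma to_quotz_repr (x : quotz) : to_quotz (repr x) = x.
Proof. exact: reprK. Qed.

Lemma to_quotzD v w : to_quotz (v + w) = to_quotz v + to_quotz w.
Proof. by rewrite /to_quotz raddfD. Qed.

Definition quotz_scale (r : R) (x : quotz) : quotz := to_quotz (r *: repr x).

Lemma quotz_scaleE r v : quotz_scale r (to_quotz v) = to_quotz (r *: v).
Proof.
rewrite /quotz_scale; apply/to_quotzP.
have /to_quotzP[u uE] := to_quotz_repr (to_quotz v).
by exists (r *: u); rewrite -scalerBr uE !scalerA mulrC.
Qed.

Lemma quotz_scaleA a b x :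
  quotz_scale a (quotz_scale b x) = quotz_scale (a * b) x.
Proof. by rewrite -[x]to_quotz_repr !quotz_scaleE scalerA. Qed.

Lemma quotz_scale1 : left_id 1 quotz_scale.
Proof. by move=> x; rewrite -[x]to_quotz_repr quotz_scaleE scale1r. Qed.

Lemma quotz_scaleDr : right_distributive quotz_scale +%R.
Proof.
move=> a x w; rewrite -[x]to_quotz_repr -[w]to_quotz_repr.
by rewrite -to_quotzD !quotz_scaleE scalerDr to_quotzD.
Qed.

Lemma quotz_scaleDl x : {morph quotz_scale^~ x : a b / a + b}.
Proof.
by move=> a b; rewrite -[x]to_quotz_repr !quotz_scaleE scalerDl to_quotzD.
Qed.

HB.instance Definition _ := GRing.Zmodule_isLmodule.Build R quotz
  quotz_scaleA quotz_scale1 quotz_scaleDr quotz_scaleDl.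

End QuotientByElement.

(* The other usual requirement, M / zM <> 0, is part of rel_CM for M / zM. *)
Definition regular_on (R : comNzRingType) (M : lmodType R) (z : R) : Prop :=
  forall v : M, z *: v = 0 -> v = 0.

Definition fin_gen (R : comNzRingType) (M : lmodType R) : Prop :=
  exists k (g : 'I_k -> M), forall v, exists a : 'I_k -> R,
    v = \sum_(i < k) a i *: g i.

(* The x-variables are the first m variables, the y-variables the last n. *)

Section Bigraded.
Variables (K : fieldType) (m n : nat).
Local Notation S := {mpoly K[m + n]}.

Definition yvar (j : 'I_n) : S := 'X_(rshift m j).

Definition in_Q (z : S) : Prop :=
  exists a : 'I_n -> S, z = \sum_(j < n) a j * yvar j.

Definition xdeg (u : 'X_{1..m + n}) : nat := (\sum_(i < m) u (lshift n i))%N.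
Definition ydeg (u : 'X_{1..m + n}) : nat := (\sum_(j < n) u (rshift m j))%N.

Definition bihomog (a b : nat) (p : S) : Prop :=
  {in msupp p, forall u, xdeg u = a /\ ydeg u = b}.

Definition bihomogeneous (p : S) : Prop := exists a b, bihomog a b p.

Section Module.
Variable M : lmodType S.

(* G d is the component of bidegree d. *)
Record bigrading (G : int * int -> M -> Prop) : Prop := Bigrading {
  bigr0 : forall d, G d 0;
  bigrB : forall d v w, G d v -> G d w -> G d (v - w);
  bigrZ : forall (a b : nat) (d : int * int) p v,
    bihomog a b p -> G d v -> G (d.1 + a%:Z, d.2 + b%:Z) (p *: v);
  bigr_dec : forall v, exists (s : seq (int * int)) (h : int * int -> M),
    (forall d, G d (h d)) /\ v = \sum_(d <- s) h d;
  bigr_indep : forall (s : seq (int * int)) (h : int * int -> M),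
    uniq s -> (forall d, G d (h d)) -> \sum_(d <- s) h d = 0 ->
    forall d, d \in s -> h d = 0
}.

Definition lcQ_zero (i : nat) : Prop := lc_zero M yvar i.

Definition rel_CM (G : int * int -> M -> Prop) : Prop :=
  [/\ bigrading G, fin_gen M, (exists v : M, v <> 0)
    & exists q, forall i, i <> q -> lcQ_zero i].

(* rdim(Q, M) = q. The nonvanishing clause makes q unique; under rel_CM it says
   that the least and the largest i with H^i_Q(M) <> 0 are both q. *)
Definition is_rdim (q : nat) : Prop :=
  ~ lcQ_zero q /\ forall i, i <> q -> lcQ_zero i.

Definition quotz_grading (z : S) (G : int * int -> M -> Prop)
    (d : int * int) (x : quotz M z) : Prop :=
  exists2 v, G d v & x = to_quotz z v.

End Module.
End Bigraded.

(* Main.v *)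
Require Import Defs.
From HB Require Import structures.
From mathcomp Require Import all_boot all_algebra.
From mathcomp Require Import zify ring.
From mathcomp Require Import boolp classical_sets cardinality.
(* Again, because of the name clashes with [classical_sets] and [fraction]. *)
From mathcomp Require Import finset.
Import Defs.

Set Implicit Arguments.
Unset Strict Implicit.
Unset Printing Implicit Defensive.

Import GRing.Theory.
Local Open Scope ring_scope.

(* Proof idea. The element is [z = sum_j t ^ j y_j] for a generic [t] in [K]
   ("generic" means outside a finite set). Since [H^0_Q(M) = 0] and [M] is
   noetherian, [z] is [M]-regular for generic [t]; then [H^i_Q(M/zM) = 0] for
   [i] different from [q - 1] and [q], and [H^(q-1)_Q(M/zM) <> 0] because
   [H^q_Q(M)] is nonzero and [Q]-torsion. What remains is [H^q_Q(M/zM) = 0].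

   Let [W] be the part of [M] of [x]-degree at most [a], where [a] bounds the
   degrees of the generators of [M]. It is a direct summand of [M] over [K[y]],
   so [H^i_Q(W) = 0] for [i > q], and it is a quotient of [M] over [S] on which
   the [x_i] are nilpotent, so all [H^i_Q(W)] are artinian (Melkersson's
   criterion and induction on [i]). Moreover [H^q_Q(W) = Q H^q_Q(W)]: modulo
   [Q]-torsion, [W] may be replaced by its quotient by a generic linear form
   until [Q] kills it. An artinian module [A = QA] satisfies [A = zA] for
   generic [z]: in a minimal counterexample [A], infinitely many [zA] are proper
   submodules of [A], hence not counterexamples, and [n] of them add up to [A].
   Therefore [H^i_Q(W/zW) = 0] for [i >= q].

   Finally, vanishing above [q - 1] passes from [W/zW] to the module [M/zM] it
   generates, by induction on the cohomological dimension: a further generic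
   linear form lowers it for [W], and in dimension 0 Nakayama's lemma gives an
   element of [1 + Q] and in [K[y]] that maps [W], hence [M], to [Q]-torsion. *)

(** * Chain conditions for a preorder *)

Section ChainConditions.
Variables (T : Type) (le : T -> T -> Prop).
Hypothesis le_refl : forall x, le x x.
Hypothesis le_trans : forall y x z, le x y -> le y z -> le x z.

(** The order is a parameter, so that [ple] gives the ascending and [pge] the descending chain
    condition. *)
Definition chain_cond (P : T -> Prop) : Prop :=
  forall E : nat -> T, (forall k, P (E k)) -> (forall k, le (E k) (E k.+1)) ->
  exists k, forall j, (k <= j)%N -> le (E j) (E k).

Lemma chain_mono (E : nat -> T) : (forall k, le (E k) (E k.+1)) ->
  forall i j, (i <= j)%N -> le (E i) (E j).
Proof.
move=> EE i j /subnKC <-; elim: (j - i)%N => [|k IH]; first by rewrite addn0.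
by rewrite addnS; apply: le_trans IH _.
Qed.

Lemma chain_cond_sub (P P' : T -> Prop) :
  (forall x, P x -> P' x) -> chain_cond P' -> chain_cond P.
Proof. by move=> PP' cP E PE; apply: cP => k; apply: PP'. Qed.

(** Dependent choice: without a maximal element, repeated strict enlargement starting at [x0] would
    be a chain that never stops. With [pge] this produces minimal elements. *)
Lemma chain_max (P Q : T -> Prop) (x0 : T) : chain_cond P ->
  (forall x, Q x -> P x) -> Q x0 ->
  exists2 x, Q x & forall x', Q x' -> le x x' -> le x' x.
Proof.
move=> cP QP Qx0; apply: contrapT => noM.
have step (x : {x | Q x}) :
    exists x' : {x | Q x}, le (sval x) (sval x') /\ ~ le (sval x') (sval x).
  apply: contrapT => nox; apply: noM; exists (sval x); first exact: svalP.
  move=> x' Qx' lexx'; apply: contrapT => nle; apply: nox.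
  by exists (exist _ x' Qx').
have [f fP] := choice step.
pose E := fix E k := if k is k'.+1 then f (E k') else exist _ x0 Qx0.
have [||k kP] := cP (fun k => sval (E k)).
- by move=> k; apply/QP/svalP.
- by move=> k; case: (fP (E k)).
- by case: (fP (E k)) => _; apply; apply: (kP k.+1).
Qed.

(* The constancy threshold in the first index is uniform in the second one. *)
Lemma double_chain (P : T -> Prop) (F : nat -> nat -> T) : chain_cond P ->
  (forall j d, P (F j d)) -> (forall j d, le (F j d) (F j.+1 d)) ->
  (forall j d, le (F j d) (F j d.+1)) ->
  exists J, forall j d, (J <= j)%N -> le (F j d) (F J d).
Proof.
move=> cP PF F1 F2.
have mon j d j' d' : (j <= j')%N -> (d <= d')%N -> le (F j d) (F j' d').
  move=> jj' dd'; apply: (@le_trans (F j' d)).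
    exact: (@chain_mono (fun j => F j d)).
  exact: (@chain_mono (F j')).
(* The diagonal stabilizes at [k], which controls all [d >= k]; the finitely many [d < k] are
   treated one at a time. *)
have [|k kP] := cP (fun k => F k k) (fun k => PF k k).
  by move=> k; apply: mon.
have [J JP] : exists J, forall j d, (d < k)%N -> (J <= j)%N -> le (F j d) (F J d).
  elim: {1}k => [|k' [J JP]]; first by exists 0%N.
  have [J' J'P] := cP (F^~ k') (PF^~ k') (F1^~ k').
  exists (maxn J J') => j d; rewrite ltnS leq_eqVlt geq_max.
  case/predU1P => [->|dk'] /andP[Jj J'j].
    by apply: le_trans (J'P _ J'j) _; apply: mon; rewrite ?leq_maxr.
  by apply: le_trans (JP _ _ dk' Jj) _; apply: mon; rewrite ?leq_maxl.
exists (maxn J k) => j d; rewrite geq_max => /andP[Jj kj].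
have [dk|kd] := ltnP d k.
  by apply: le_trans (JP _ _ dk Jj) _; apply: mon; rewrite ?leq_maxl.
apply: (@le_trans (F (maxn j d) (maxn j d))).
  by apply: mon; rewrite ?leq_maxl ?leq_maxr.
apply: (@le_trans (F k k)); first by apply: kP; rewrite leq_max kj.
by apply: mon; rewrite ?leq_maxr.
Qed.

End ChainConditions.

(** * Submodules under inclusion and reverse inclusion, and Hilbert's basis theorem *)

Definition ple (T : Type) (E F : T -> Prop) := forall v, E v -> F v.
Definition pge (T : Type) (E F : T -> Prop) := forall v, F v -> E v.

Lemma ple_refl T (E : T -> Prop) : ple E E. Proof. by move=> v. Qed.
Lemma ple_trans T (F E G : T -> Prop) : ple E F -> ple F G -> ple E G.
Proof. by move=> EF FG v /EF/FG. Qed.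
Lemma pge_refl T (E : T -> Prop) : pge E E. Proof. by move=> v. Qed.
Lemma pge_trans T (F E G : T -> Prop) : pge E F -> pge F G -> pge E G.
Proof. by move=> EF FG v /FG/EF. Qed.

Section Submodules.
Variables (R : comNzRingType) (M : lmodType R).
Implicit Types (L E V Z B : M -> Prop) (A : R -> Prop).

Definition osub A L : Prop :=
  [/\ L 0, forall u v, L u -> L v -> L (u - v)
    & forall a u, A a -> L u -> L (a *: u)].

Section OSub.
Variables (A : R -> Prop) (L : M -> Prop).
Hypothesis hL : osub A L.
Lemma osub0 : L 0. Proof. by case: hL. Qed.
Lemma osubB u v : L u -> L v -> L (u - v). Proof. by case: hL => _ h _; apply: h. Qed.
Lemma osubN u : L u -> L (- u). Proof. by rewrite -sub0r; apply: osubB osub0. Qed.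
Lemma osubD u v : L u -> L v -> L (u + v).
Proof. by move=> hu hv; rewrite -(opprK v); apply/osubB/osubN. Qed.
Lemma osubZ a u : A a -> L u -> L (a *: u).
Proof. by case: hL => _ _ h; apply: h. Qed.
Lemma osub_sum (I : Type) (r : seq I) (P : pred I) (F : I -> M) :
  (forall i, P i -> L (F i)) -> L (\sum_(i <- r | P i) F i).
Proof. by move=> h; apply: (big_ind L osub0 osubD). Qed.
Lemma osub_sum_in (I : eqType) (r : seq I) (P : pred I) (F : I -> M) :
  (forall i, i \in r -> P i -> L (F i)) -> L (\sum_(i <- r | P i) F i).
Proof.
move=> h; rewrite big_seq_cond; apply: osub_sum => i /andP[]; exact: h.
Qed.
End OSub.

Definition submod := osub (fun _ => True).

Lemma submodZ L : submod L -> forall a u, L u -> L (a *: u).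
Proof. by move=> hL a u; apply: (osubZ hL). Qed.

Definition noeth := chain_cond (@ple M) submod.

(** The subquotient [Z/B] is artinian. It is never formed: its submodules are those between [B] and
    [Z], and in the applications these are cocycles and coboundaries. *)
Definition dcc Z B := chain_cond (@pge M)
  (fun E => [/\ submod E, forall v, B v -> E v & forall v, E v -> Z v]).

Definition addop A (x : R) : R -> Prop := fun a => A a \/ a = x.

Definition polyspan V (x : R) : M -> Prop := fun v =>
  exists d (w : nat -> M), (forall i, V (w i)) /\ v = \sum_(i < d) x ^+ i *: w i.

Lemma polyspan_pad V (x : R) d (w : nat -> M) e : V 0 -> (forall i, V (w i)) ->
  (d <= e)%N -> exists w' : nat -> M, (forall i, V (w' i)) /\
  \sum_(i < d) x ^+ i *: w i = \sum_(i < e) x ^+ i *: w' i.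
Proof.
move=> V0 hw de; exists (fun i => if (i < d)%N then w i else 0); split.
  by move=> i; case: ifP.
rewrite (big_ord_widen _ (fun i => x ^+ i *: w i) de) big_mkcond /=.
by apply: eq_bigr => i _; case: ifP => // _; rewrite scaler0.
Qed.

Lemma polyspan_osub A V x : osub A V -> osub (addop A x) (polyspan V x).
Proof.
move=> hV; have V0 := osub0 hV; split.
- by exists 0%N, (fun=> 0); rewrite big_ord0.
- move=> u v [d [w [hw ->]]] [e [w' [hw' ->]]].
  have [w1 [hw1 ->]] := polyspan_pad x V0 hw (leq_maxl d e).
  have [w2 [hw2 ->]] := polyspan_pad x V0 hw' (leq_maxr d e).
  exists (maxn d e), (fun i => w1 i - w2 i); split.
    by move=> i; apply: (osubB hV).
  by rewrite -sumrB; apply: eq_bigr => i _; rewrite scalerBr.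
- move=> a u [Aa|->] [d [w [hw ->]]].
    exists d, (fun i => a *: w i); split; first by move=> i; apply: (osubZ hV).
    by rewrite scaler_sumr; apply: eq_bigr => i _; rewrite !scalerA mulrC.
  exists d.+1, (fun i => if i is j.+1 then w j else 0); split; first by case.
  rewrite big_ord_recl scaler0 add0r scaler_sumr.
  by apply: eq_bigr => i _; rewrite scalerA -exprS.
Qed.

(* The polynomial step of Hilbert's basis theorem, for operators on a module:
   [F k d] collects the coefficients of [x ^+ d] in elements of [E k] of degree
   at most [d]. The expansion in powers of [x] need not be unique. *)
Lemma hilbert_step A V (x : R) : osub A V ->
  chain_cond (@ple M) (fun E => osub A E /\ ple E V) ->
  chain_cond (@ple M) (fun E => osub (addop A x) E /\ ple E (polyspan V x)).
Proof.
move=> hV cV E hE EE; have V0 := osub0 hV.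
pose F k d w := V w /\ exists w' : nat -> M, (forall i, V (w' i)) /\
  E k (x ^+ d *: w + \sum_(i < d) x ^+ i *: w' i).
have [|||J JP] := @double_chain _ (@ple M) (@ple_refl M) (@ple_trans M)
    (fun E => osub A E /\ ple E V) F cV.
- move=> k d; split; last by move=> v [].
  have [[hE0 hEB hEZ] _] := hE k; split.
  + split=> //; exists (fun=> 0); split=> //.
    by rewrite scaler0 add0r big1 // => i _; rewrite scaler0.
  + move=> u v [Vu [u' [hu' Eu]]] [Vv [v' [hv' Ev]]].
    split; first exact: (osubB hV).
    exists (fun i => u' i - v' i); split; first by move=> i; apply: (osubB hV).
    move: (hEB _ _ Eu Ev); congr (E k _).
    rewrite scalerBr opprD addrACA -sumrB; congr (_ + _).
    by apply: eq_bigr => i _; rewrite scalerBr.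
  + move=> a u Aa [Vu [u' [hu' Eu]]]; split; first exact: (osubZ hV).
    exists (fun i => a *: u' i); split; first by move=> i; apply: (osubZ hV).
    move: (hEZ _ _ (or_introl Aa) Eu); congr (E k _).
    rewrite scalerDr !scalerA mulrC scaler_sumr; congr (_ + _).
    by apply: eq_bigr => i _; rewrite !scalerA mulrC.
- by move=> k d v [Vv [v' [hv' /EE Ev]]]; split=> //; exists v'.
- move=> k d v [Vv [v' [hv' Ev]]]; split=> //.
  exists (fun i => if i is j.+1 then v' j else 0); split; first by case.
  have [[_ _ hEZ] _] := hE k.
  move: (hEZ _ _ (or_intror erefl) Ev); congr (E k _).
  rewrite scalerDr scalerA -exprS big_ord_recl scaler0 add0r scaler_sumr.
  by congr (_ + _); apply: eq_bigr => i _; rewrite scalerA -exprS.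
exists J => j Jj.
have EJj : ple (E J) (E j).
  exact: (chain_mono (@ple_refl M) (@ple_trans M) EE Jj).
move=> v Ev; have [_ /(_ _ Ev)[d [w [hw ev]]]] := hE j.
(* Induction on the number of terms: the leading coefficient already occurs in [F J d], so
   subtracting an element of [E J] removes the top power of [x]. *)
elim: d v w hw ev Ev => [|d IH] v w hw ev Ev.
  by rewrite ev big_ord0; have [[]] := hE J.
have [|Vw [w' [hw' Ew']]] := JP j d Jj (w d).
  by split=> //; exists w; split=> //; rewrite addrC; move: Ev; rewrite ev big_ord_recr.
have -> : v = (v - (x ^+ d *: w d + \sum_(i < d) x ^+ i *: w' i))
             + (x ^+ d *: w d + \sum_(i < d) x ^+ i *: w' i).
  by rewrite subrK.
apply: (osubD (hE J).1) => //.
apply: (IH _ (fun i => w i - w' i)) => //.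
- by move=> i; apply: (osubB hV).
- rewrite ev big_ord_recr /= opprD addrA addrK -sumrB.
  by apply: eq_bigr => i _; rewrite scalerBr.
- by apply: (osubB (hE j).1) => //; apply: EJj.
Qed.

(** A maximal finitely generated submodule of [L] absorbs every further generator [v]. *)
Lemma noeth_fg L : noeth -> submod L -> exists r (g : 'I_r -> M),
  (forall i, L (g i)) /\
  forall v, L v -> exists a : 'I_r -> R, v = \sum_(i < r) a i *: g i.
Proof.
move=> nM hL.
pose span r (g : 'I_r -> M) v := exists a : 'I_r -> R, v = \sum_(i < r) a i *: g i.
pose Q E := exists r (g : 'I_r -> M), (forall i, L (g i)) /\ E = span r g.
have spanP r g : submod (span r g).
  split.
  - by exists (fun=> 0); rewrite big1 // => i _; rewrite scale0r.
  - move=> _ _ [a ->] [b ->]; exists (fun i => a i - b i).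
    by rewrite -sumrB; apply: eq_bigr => i _; rewrite scalerBl.
  - move=> c _ _ [a ->]; exists (fun i => c * a i).
    by rewrite scaler_sumr; apply: eq_bigr => i _; rewrite scalerA.
have [||E [r [g [Lg eE]]] Emax] := @chain_max _ (@ple M) submod Q
    (span 0%N (fun i => 0)) nM.
- by move=> E [r [g [_ ->]]]; apply: spanP.
- by exists 0%N, (fun=> 0); split=> //; case.
exists r, g; split=> // v Lv.
pose g' (i : 'I_r.+1) := if unlift ord0 i is Some j then g j else v.
suff : E v by rewrite eE.
apply: (Emax (span r.+1 g')).
- by exists r.+1, g'; split=> // i; rewrite /g'; case: unliftP.
- rewrite eE => _ [a ->].
  exists (fun i => if unlift ord0 i is Some j then a j else 0).
  rewrite big_ord_recl unlift_none scale0r add0r.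
  by apply: eq_bigr => i _; rewrite /g' !liftK.
- exists (fun i => if unlift ord0 i is Some j then 0 else 1).
  rewrite big_ord_recl /g' unlift_none scale1r big1 ?addr0 // => i _.
  by rewrite liftK scale0r.
Qed.

End Submodules.

(** * Finitely generated modules over a polynomial ring are noetherian *)

Section PolynomialModules.
Variables (K : fieldType) (N : nat).
Local Notation S := {mpoly K[N]}.
Variable M : lmodType S.

(** [K] acts on [M] through the constant polynomials, so [osub constop] describes the [K]-subspaces
    of [M]. *)
Definition constop (a : S) : Prop := exists c : K, a = c%:MP.

Fixpoint kspan (g : seq M) (v : M) : Prop :=
  if g is x :: g' then exists c : K, kspan g' (v - c%:MP *: x) else v = 0.

Lemma kspan_osub g : osub constop (kspan g).
Proof.
elim: g => [|x g [h0 hB hZ]]; split => //=.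
- by move=> u v -> ->; rewrite subr0.
- by move=> a u _ ->; rewrite scaler0.
- by exists 0; rewrite mpolyC0 scale0r subr0.
- move=> u v [c hc] [d hd]; exists (c - d).
  have := hB _ _ hc hd; rewrite mpolyCB scalerBl !opprD !opprK.
  by rewrite addrACA.
- move=> a u [b eb] [c hc]; exists (b * c).
  have := hZ a _ (ex_intro _ b eb) hc.
  by rewrite scalerBr scalerA eb mpolyCM.
Qed.

Lemma kspan_sub g x v : kspan g v -> kspan (x :: g) v.
Proof. by exists 0; rewrite mpolyC0 scale0r subr0. Qed.

Lemma kspan_mem g x : x \in g -> kspan g x.
Proof.
elim: g => //= y g IH; rewrite inE => /predU1P[->|/IH]; last exact: kspan_sub.
by exists 1; rewrite mpolyC1 scale1r subrr; apply: osub0 (kspan_osub g).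
Qed.

(** Nested subspaces of the span of [x :: g] coincide if they meet the span of [g] equally and agree
    on whether some element has [x]-coefficient 1. Both chain conditions for finite-dimensional
    spaces rest on this. *)
Lemma osub_extend g x (E E' : M -> Prop) :
  osub constop E -> osub constop E' -> ple E (kspan (x :: g)) -> ple E' E ->
  (forall v, E v -> kspan g v -> E' v) ->
  ((exists2 w, kspan g w & E (x + w)) -> exists2 w, kspan g w & E' (x + w)) ->
  ple E E'.
Proof.
move=> hE hE' Eg E'E EgE' lead v Ev; have [c vc] := Eg v Ev.
have hg := kspan_osub g.
have [c0|c0] := eqVneq c 0.
  by apply: EgE' => //; move: vc; rewrite c0 mpolyC0 scale0r subr0.
have cV (u : M) : (c^-1)%:MP *: (c%:MP *: u) = u.
  by rewrite scalerA -mpolyCM mulVf // mpolyC1 scale1r.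
have cst (d : K) : constop d%:MP by exists d.
have [|w gw E'w] := lead.
  exists ((c^-1)%:MP *: (v - c%:MP *: x)); first exact: (osubZ hg).
  rewrite scalerBr cV addrC subrK.
  exact: (osubZ hE).
have E'cw : E' (c%:MP *: (x + w)) by apply: (osubZ hE').
rewrite -[v](subrK (c%:MP *: (x + w))); apply: (osubD hE') => //.
apply: EgE'; first by apply: (osubB hE) => //; apply: E'E.
rewrite scalerDr opprD addrA; apply: (osubB hg) => //.
exact: (osubZ hg).
Qed.

Lemma kspan_acc g :
  chain_cond (@ple M) (fun E => osub constop E /\ ple E (kspan g)).
Proof.
elim: g => [|x g IH] E hE EE.
  exists 0%N => j _ v /(proj2 (hE j) v) ->; exact: (osub0 (hE 0%N).1).
have mon := chain_mono (@ple_refl M) (@ple_trans M) EE.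
have [||k1 k1P] := IH (fun k v => E k v /\ kspan g v).
- move=> k; split; last by move=> v [].
  have [[h0 hB hZ] _] := hE k; have [g0 gB gZ] := kspan_osub g.
  split=> //; first by move=> u v [? ?] [? ?]; split; [apply: hB|apply: gB].
  by move=> a u ? [? ?]; split; [apply: hZ|apply: gZ].
- by move=> k v [/EE].
(* Along the chain [b] can change its truth value at most once. *)
pose b k := exists2 w, kspan g w & E k (x + w).
have [k2 k2P] : exists k, forall j, b j -> b k.
  have [[k bk]|nb] := pselect (exists k, b k); first by exists k.
  by exists 0%N => j bj; case: nb; exists j.
pose k := maxn k1 k2; exists k => j kj.
have k1k : (k1 <= k)%N by exact: leq_maxl.
apply: (@osub_extend g x) => //.
- by case: (hE j).
- by case: (hE k).
- by case: (hE j).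
- exact: mon.
- move=> v Ev gv; have [|] := k1P j (leq_trans k1k kj) v; first by [].
  by move=> E1 _; apply: mon E1.
- by move/k2P => [w gw Ew]; exists w => //; apply: mon Ew; apply: leq_maxr.
Qed.

Lemma kspan_dcc g :
  chain_cond (@pge M) (fun E => osub constop E /\ ple E (kspan g)).
Proof.
elim: g => [|x g IH] E hE EE.
  exists 0%N => j _ v /(proj2 (hE 0%N) v) ->; exact: (osub0 (hE j).1).
have mon := chain_mono (@pge_refl M) (@pge_trans M) EE.
have [||k1 k1P] := IH (fun k v => E k v /\ kspan g v).
- move=> k; split; last by move=> v [].
  have [[h0 hB hZ] _] := hE k; have [g0 gB gZ] := kspan_osub g.
  split=> //; first by move=> u v [? ?] [? ?]; split; [apply: hB|apply: gB].
  by move=> a u ? [? ?]; split; [apply: hZ|apply: gZ].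
- by move=> k v [/EE].
pose b k := exists2 w, kspan g w & E k (x + w).
have [k2 k2P] : exists k, forall j, b k -> b j.
  have [[k nbk]|nb] := pselect (exists k, ~ b k); first by exists k.
  by exists 0%N => j _; apply: contrapT => nbj; apply: nb; exists j.
pose k := maxn k1 k2; exists k => j kj.
have k1k : (k1 <= k)%N by exact: leq_maxl.
apply: (@osub_extend g x) => //.
- by case: (hE k).
- by case: (hE j).
- by case: (hE k).
- exact: mon.
- move=> v Ev gv; have [|//] := k1P j (leq_trans k1k kj) v.
  by split=> //; apply: mon Ev.
- move=> [w gw Ew]; apply: k2P; exists w => //.
  by apply: mon Ew; apply: leq_maxr.
Qed.

Lemma mpoly_ring_ind (P : S -> Prop) : (forall c : K, P c%:MP) ->
  (forall i : 'I_N, P 'X_i) -> (forall p q, P p -> P q -> P (p + q)) ->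
  (forall p q, P p -> P q -> P (p * q)) -> forall p, P p.
Proof.
move=> PC PX PD PM p.
have P1 : P 1 by rewrite -mpolyC1; apply: PC.
elim/mpolyind: p => [|c m p _ _ Pp]; first by rewrite -mpolyC0; apply: PC.
apply: (PD _ _ _ Pp); rewrite -mul_mpolyC; apply: (PM _ _); first exact: PC.
rewrite mpolyXE_id; apply: (big_ind P P1 PM) => i _.
elim: (m i) => [|e IH]; first by rewrite expr0.
by rewrite exprS; apply: PM.
Qed.

Lemma submod_consts_vars A (L : M -> Prop) : osub A L ->
  (forall c : K, A c%:MP) -> (forall i : 'I_N, A 'X_i) -> submod L.
Proof.
move=> hL Ac AX; split; [exact: osub0 hL|exact: osubB hL|] => p u _ Lu.
elim/mpoly_ring_ind: p u Lu => [c|i|p q IHp IHq|p q IHp IHq] u Lu.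
- exact: (osubZ hL).
- exact: (osubZ hL).
- by rewrite scalerDl; apply: (osubD hL); [apply: IHp|apply: IHq].
- by rewrite -scalerA; apply/IHp/IHq.
Qed.

(** The chain condition holds on the finite-dimensional [K]-span of the generators. [hilbert_step]
    then adjoins the variables one by one, and the last stage of the tower [W] is all of [M]. *)
Lemma fin_gen_noeth : fin_gen M -> noeth M.
Proof.
move=> [r [g gP]]; pose gs := [seq g i | i <- enum 'I_r].
pose W := fix W (s : seq 'I_N) :=
  if s is i :: s' then polyspan (W s') 'X_i else kspan gs.
pose A := fix A (s : seq 'I_N) : S -> Prop :=
  if s is i :: s' then addop (A s') 'X_i else constop.
have WA s : osub (A s) (W s).
  by elim: s => [|i s IH] /=; [apply: kspan_osub|apply: polyspan_osub].
have acc s : chain_cond (@ple M) (fun E => osub (A s) E /\ ple E (W s)).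
  elim: s => [|i s IH] /=; first exact: kspan_acc.
  exact: hilbert_step (WA s) IH.
have gW s i : W s (g i).
  elim: s => [|j s IH] /=.
    by apply/kspan_mem/map_f; rewrite mem_enum.
  have W0 := osub0 (WA s).
  exists 1%N, (fun=> g i); split=> //; by rewrite big_ord1 expr0 scale1r.
have Ac s c : A s c%:MP by elim: s => [|i s IH] /=; [exists c|left].
have AX s i : i \in s -> A s 'X_i.
  elim: s => //= j s IH; rewrite inE => /predU1P[->|/IH]; by [right|left].
have Wsub : submod (W (enum 'I_N)).
  apply: submod_consts_vars (WA _) (Ac _) _ => i.
  by apply: AX; rewrite mem_enum.
apply: chain_cond_sub (acc (enum 'I_N)) => E hE; split.
  by have [h0 hB hZ] := hE; split=> // a u _; apply: hZ.
move=> v _; have [a ->] := gP v; apply: (osub_sum Wsub) => i _.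
exact: submodZ.
Qed.

(** Monomials of positive degree kill [Z], so polynomials act on it through constants; being
    finitely generated, [Z] is then finite-dimensional over [K]. *)
Lemma socle_dcc (Z : M -> Prop) : noeth M -> submod Z ->
  (forall v i, Z v -> 'X_i *: v = 0) -> dcc Z (fun v => v = 0).
Proof.
move=> nM hZ ZX; have [r [g [Zg gP]]] := noeth_fg nM hZ.
pose gs := [seq g i | i <- enum 'I_r].
have scal (p : S) v : Z v -> exists c : K, p *: v = c%:MP *: v.
  move=> Zv; elim/mpolyind: p => [|c m p _ _ [d dE]].
    by exists 0; rewrite mpolyC0.
  have [i mi|m0] := pickP (fun i => m i != 0%N); last first.
    have -> : m = 0%MM by apply/mnmP => i; rewrite mnm0E; apply/eqP/negbFE/m0.
    exists (c + d); rewrite scalerDl dE mpolyX0 -mul_mpolyC mulr1.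
    by rewrite mpolyCD scalerDl.
  exists d; rewrite scalerDl dE.
  have -> : 'X_[m] = 'X_[m - U_(i)] * 'X_i :> S.
    by rewrite -mpolyXD submK // lep1mP.
  by rewrite -mul_mpolyC -!scalerA ZX // !scaler0 add0r.
have Zgs : ple Z (kspan gs).
  move=> v /gP[a ->]; apply: (osub_sum (kspan_osub gs)) => i _.
  have [c ->] := scal (a i) _ (Zg i).
  apply: (osubZ (kspan_osub gs)); first by exists c.
  by apply/kspan_mem/map_f; rewrite mem_enum.
apply: (chain_cond_sub _ (kspan_dcc (g := gs))) => E [[h0 hB hEZ] _ EZ]; split.
  by split=> // a u _; apply: hEZ.
by move=> v /EZ/Zgs.
Qed.

End PolynomialModules.

(** * Generic linear forms in the [y]-variables *)

Section Generic.
Variables (K : fieldType) (m n : nat).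
Local Notation S := {mpoly K[m + n]}.
Local Notation yv := (@yvar K m n).

(* Any [n] of these linear forms, for distinct [t], span the same space as the
   [y_j] (Vandermonde). *)
Definition ylin (t : K) : S := \sum_(j < n) (t ^+ j)%:MP * yv j.

Definition generic (P : K -> Prop) : Prop :=
  exists s : seq K, forall t, t \notin s -> P t.

Lemma genericI P P' : generic P -> generic P' -> generic (fun t => P t /\ P' t).
Proof.
move=> [s sP] [s' sP']; exists (s ++ s') => t.
by rewrite mem_cat negb_or => /andP[/sP ? /sP'].
Qed.

Lemma generic_forall (T : eqType) (r : seq T) (P : T -> K -> Prop) :
  (forall x, x \in r -> generic (P x)) ->
  generic (fun t => forall x, x \in r -> P x t).
Proof.
elim: r => [|x r IH] h; first by exists [::] => t _ x.
have [|s sP] := genericI (h x (mem_head _ _)) (IH _).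
  by move=> x' x'r; apply: h; rewrite inE x'r orbT.
by exists s => t /sP[Px Pr] x'; rewrite inE => /predU1P[->|/Pr].
Qed.

Lemma not_generic P : ~ generic P -> forall k,
  exists ts : seq K, [/\ uniq ts, size ts = k & forall t, t \in ts -> ~ P t].
Proof.
move=> nP; elim=> [|k [ts [uts <- tsP]]]; first by exists [::].
have [t [tts nPt]] : exists t, t \notin ts /\ ~ P t.
  apply: contrapT => no; apply: nP; exists ts => t tts.
  by apply: contrapT => nPt; apply: no; exists t.
exists (t :: ts); split=> //=; first by rewrite tts.
by move=> t'; rewrite inE => /predU1P[->|/tsP].
Qed.

Lemma generic_ex P : infinite_set [set: K] -> generic P -> exists t, P t.
Proof.
move=> infK [s sP]; apply: contrapT => no; apply: infK.
apply/finite_seqP; exists s; apply/seteqP; split=> // t _ /=.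
by apply: contrapT => /negP/sP Pt; apply: no; exists t.
Qed.

(** The Vandermonde matrix of distinct parameters is invertible over [K]; column [l] of its inverse
    expresses [u l] through the given sums. *)
Lemma vandermonde_sub (M : lmodType S) (L : M -> Prop) (u : 'I_n -> M)
    (ts : seq K) : submod L -> uniq ts -> size ts = n ->
  (forall t, t \in ts -> L (\sum_(j < n) (t ^+ j)%:MP *: u j)) ->
  forall j, L (u j).
Proof.
move=> hL uts sts tsL l.
pose a : 'rV[K]_n := \row_i nth 0 ts i.
pose V := Vandermonde n a.
have Vu : V \in unitmx.
  rewrite unitmxE det_Vandermonde unitfE; apply/prodf_neq0 => i _.
  apply/prodf_neq0 => j ij; rewrite !mxE subr_eq0 nth_uniq ?sts //.
  by rewrite neq_ltn ij orbT.
have -> : u l = \sum_(i < n) (invmx V i l)%:MP *: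
    \sum_(j < n) ((nth 0 ts i) ^+ j)%:MP *: u j.
  under eq_bigr do rewrite scaler_sumr.
  rewrite exchange_big /=.
  have E (j : 'I_n) : \sum_(i < n) (invmx V i l)%:MP *: ((nth 0 ts i ^+ j)%:MP *: u j)
      = ((j == l)%:R : K)%:MP *: u j.
    have := congr1 (fun A : 'M[K]_n => A j l) (mulmxV Vu); rewrite !mxE => <-.
    rewrite raddf_sum scaler_suml /=; apply: eq_bigr => i _.
    by rewrite !mxE scalerA -mpolyCM mulrC.
  under eq_bigr do rewrite E.
  rewrite (bigD1 l) //= eqxx mpolyC1 scale1r big1 ?addr0 // => j /negPf ->.
  by rewrite mpolyC0 scale0r.
apply: (osub_sum hL) => i _; apply: submodZ => //.
by apply: tsL; rewrite mem_nth // sts.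
Qed.

Lemma ylin_span (M : lmodType S) (L : M -> Prop) (v : M) (ts : seq K) :
  submod L -> uniq ts -> size ts = n ->
  (forall t, t \in ts -> L (ylin t *: v)) -> forall j, L (yv j *: v).
Proof.
move=> hL uts sts tsL; apply: (vandermonde_sub hL uts sts) => t /tsL.
rewrite /ylin scaler_suml; congr (L _).
by apply: eq_bigr => j _; rewrite scalerA.
Qed.

(** Noetherian induction on [L], for regularity on [M/L]. At a maximal counterexample take [n] bad
    parameters [t]. Each [ker t] is strictly larger than [L] and inherits the socle condition, so it
    is no counterexample. A parameter good for all these kernels is good for [L], because the bad
    forms span the [y_j]. *)
Lemma generic_regular (M : lmodType S) : noeth M ->
  (forall v : M, (forall j, yv j *: v = 0) -> v = 0) ->
  generic (fun t => regular_on M (ylin t)).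
Proof.
move=> nM soc0.
pose good (L : M -> Prop) t := forall v, L (ylin t *: v) -> L v.
suff [s sP] : generic (good (fun v => v = 0)) by exists s.
apply: contrapT => ng.
pose Q (L : M -> Prop) := [/\ submod L,
  (forall v, (forall j, L (yv j *: v)) -> L v) & ~ generic (good L)].
have sub0 : submod (fun v : M => v = 0).
  split=> //; first by move=> u v -> ->; rewrite subr0.
  by move=> a u _ ->; rewrite scaler0.
have [||L [hL Lsoc Lbad] Lmax] :=
    @chain_max _ (@ple M) _ Q (fun v => v = 0) nM.
- by move=> L [].
- by split.
have [ts [uts sts tsbad]] := not_generic Lbad n.
pose ker t v := L (ylin t *: v).
have Lker t : ple L (ker t) by move=> v; apply: submodZ.
apply: Lbad; have [|s sP] := @generic_forall _ ts (fun t => good (ker t)).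
- move=> t /tsbad tbad; apply: contrapT => kbad; apply: tbad.
  apply: (Lmax (ker t)) => //; split=> //.
    have [h0 hB hZ] := hL; split; rewrite /ker.
    + by rewrite scaler0.
    + by move=> u v Lu Lv; rewrite scalerBr; apply: hB.
    + by move=> a u _ Lu; rewrite scalerA mulrC -scalerA; apply: hZ.
  by move=> v hv; apply: Lsoc => j; rewrite scalerA mulrC -scalerA; apply: hv.
exists s => t /sP tgood v Ltv; apply: Lsoc.
apply: (ylin_span hL uts sts) => t' t'ts; apply: tgood t'ts _ _.
by rewrite /ker; apply: Lker.
Qed.

(* Dual to [generic_regular], for the subquotient [Z/B]. *)
Lemma generic_divisible (C : lmodType S) (Z B : C -> Prop) :
  submod Z -> submod B -> ple B Z -> dcc Z B ->
  (forall c, Z c -> exists (a : 'I_n -> C) b,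
     [/\ forall j, Z (a j), B b & c = \sum_(j < n) yv j *: a j + b]) ->
  generic (fun t => forall c, Z c ->
     exists a b, [/\ Z a, B b & c = ylin t *: a + b]).
Proof.
move=> hZ hB BZ dZB Zdiv.
pose good (E : C -> Prop) t := forall c, E c ->
  exists a b, [/\ E a, B b & c = ylin t *: a + b].
pose Q (E : C -> Prop) := [/\ [/\ submod E, ple B E & ple E Z],
  (forall c, E c -> exists (a : 'I_n -> C) b,
     [/\ forall j, E (a j), B b & c = \sum_(j < n) yv j *: a j + b])
  & ~ generic (good E)].
apply: contrapT => ng.
have [||E [[hE BE EZ] Ediv Ebad] Emin] := @chain_max _ (@pge C) _ Q Z dZB.
- by move=> E [[]].
- by split=> //; split=> //; apply: ple_refl.
have [ts [uts sts tsbad]] := not_generic Ebad n.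
(* For a bad [t] this is a proper submodule of [E] that again satisfies the divisibility hypothesis,
   so by minimality it is not a counterexample. The [im t] for [t] in [ts] add up to [E], since the
   forms span the [y_j]. *)
pose im t c := exists a b, [/\ E a, B b & c = ylin t *: a + b].
have imE t : ple (im t) E.
  move=> _ [a [b [Ea /BE Eb ->]]]; apply: (osubD hE) => //; exact: submodZ.
have him t : submod (im t).
  split.
  - exists 0, 0; rewrite scaler0 addr0; split=> //; [exact: osub0 hE|exact: osub0 hB].
  - move=> _ _ [a [b [Ea Bb ->]]] [a' [b' [Ea' Bb' ->]]].
    exists (a - a'), (b - b').
    split; [exact: (osubB hE)|exact: (osubB hB)|].
    by rewrite scalerBr opprD addrACA.
  - move=> r _ _ [a [b [Ea Bb ->]]]; exists (r *: a), (r *: b).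
    split; [exact: submodZ|exact: submodZ|].
    by rewrite scalerDr !scalerA mulrC.
apply: Ebad; have [|s sP] := @generic_forall _ ts (fun t => good (im t)).
- move=> t /tsbad tbad; apply: contrapT => ibad; apply: tbad.
  apply: (Emin (im t)); last by move=> c; apply: imE.
  split=> //.
    split=> //; last by move=> c /imE/EZ.
    by move=> b Bb; exists 0, b; rewrite scaler0 add0r; split=> //; apply: osub0 hE.
  move=> _ [a [b [/Ediv[a' [b' [Ea' Bb' ->]]] Bb ->]]].
  exists (fun j => ylin t *: a' j), (ylin t *: b' + b); split.
  + by move=> j; exists (a' j), 0; rewrite addr0; split=> //; apply: osub0 hB.
  + by apply: (osubD hB) => //; apply: submodZ.
  + rewrite scalerDr addrA scaler_sumr; congr (_ + _ + _).
    by apply: eq_bigr => j _; rewrite !scalerA mulrC.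
exists s => t /sP tgood c Ec.
have Egood t' a : t' \in ts -> E a -> im t (ylin t' *: a).
  move=> t'ts Ea; have [|a' [b' [Ea' Bb' ->]]] := tgood t' t'ts (ylin t' *: a).
    by exists a, 0; rewrite addr0; split=> //; apply: osub0 hB.
  by exists a', b'; split=> //; apply: imE Ea'.
have [a [b [Ea Bb ->]]] := Ediv c Ec.
apply: (osubD (him t)).
  apply: (osub_sum (him t)) => j _.
  by apply: (ylin_span (him t) uts sts) => t' t'ts; apply: Egood.
by exists 0, b; rewrite scaler0 add0r; split=> //; apply: osub0 hE.
Qed.

End Generic.

(** * Arithmetic of fractions *)

Section Fractions.
Variables (R : comNzRingType) (M : lmodType R) (f : R).
Implicit Types (v w : M).

Lemma frac_eq v w k : frac f v k = frac f w k <->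
  exists t, f ^+ t *: v = f ^+ t *: w.
Proof.
rewrite fracP; split=> [] [t tE]; first by exists (t + k)%N.
by exists t; rewrite exprD mulrC -!scalerA tE.
Qed.

Lemma frac_raise v k t : frac f (f ^+ t *: v) (k + t) = frac f v k.
Proof. by apply/fracP; exists 0%N; rewrite !add0n scalerA exprD. Qed.

Lemma frac0 k : frac f (0 : M) k = 0.
Proof. by apply/fracP; exists 0%N; rewrite !scaler0. Qed.

Lemma fracD v w k : frac f (v + w) k = frac f v k + frac f w k.
Proof.
rewrite [RHS]loc_addE; apply/fracP; exists 0%N.
by rewrite !add0n -scalerDr !scalerA exprD.
Qed.

Lemma fracZ r v k : frac f (r *: v) k = r *: frac f v k.
Proof. by rewrite [RHS]loc_scaleE. Qed.

Lemma fracN v k : frac f (- v) k = - frac f v k.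
Proof. by rewrite -scaleN1r fracZ scaleN1r. Qed.

Lemma frac_sum (I : Type) (r : seq I) (P : pred I) (F : I -> M) k :
  frac f (\sum_(i <- r | P i) F i) k = \sum_(i <- r | P i) frac f (F i) k.
Proof. exact: (big_morph _ (fun v w => fracD v w k) (frac0 k)). Qed.

Lemma frac_eq0 v k : frac f v k = 0 <-> exists t, f ^+ t *: v = 0.
Proof.
rewrite -(frac0 k) frac_eq; split=> [] [t tE]; exists t.
  by rewrite tE scaler0.
by rewrite tE scaler0.
Qed.

End Fractions.

(** * The Cech complex as a module with a differential *)

Section CechModule.
Variables (R : comNzRingType) (M : lmodType R) (n : nat) (y : 'I_n -> R).
Local Notation C := (cech M y).
Local Notation yp := (yprod y).

HB.instance Definition _ := gen_eqMixin C.
HB.instance Definition _ := gen_choiceMixin C.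

Fact cech_addA : associative (fun c e : C => (fun s => c s + e s) : C).
Proof. by move=> a b c; apply/functional_extensionality_dep => s; rewrite addrA. Qed.
Fact cech_addC : commutative (fun c e : C => (fun s => c s + e s) : C).
Proof. by move=> a b; apply/functional_extensionality_dep => s; rewrite addrC. Qed.
Fact cech_add0 : left_id ((fun s => 0) : C) (fun c e : C => (fun s => c s + e s) : C).
Proof. by move=> a; apply/functional_extensionality_dep => s; rewrite add0r. Qed.
Fact cech_addN : left_inverse ((fun s => 0) : C) (fun c : C => (fun s => - c s) : C)
  (fun c e : C => (fun s => c s + e s) : C).
Proof. by move=> a; apply/functional_extensionality_dep => s; rewrite addNr. Qed.
HB.instance Definition _ :=
  GRing.isZmodule.Build C cech_addA cech_addC cech_add0 cech_addN.

Fact cech_scaleA a b (c : C) :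
  (fun s => a *: (b *: c s)) = (fun s => (a * b) *: c s) :> C.
Proof. by apply/functional_extensionality_dep => s; rewrite scalerA. Qed.
Fact cech_scale1 : left_id 1 (fun a (c : C) => (fun s => a *: c s) : C).
Proof. by move=> c; apply/functional_extensionality_dep => s; rewrite scale1r. Qed.
Fact cech_scaleDr : right_distributive (fun a (c : C) => (fun s => a *: c s) : C) +%R.
Proof. by move=> a b c; apply/functional_extensionality_dep => s; apply: scalerDr. Qed.
Fact cech_scaleDl (c : C) :
  {morph (fun a => (fun s => a *: c s) : C) : a b / a + b}.
Proof. by move=> a b; apply/functional_extensionality_dep => s; apply: scalerDl. Qed.
HB.instance Definition _ := GRing.Zmodule_isLmodule.Build R C
  cech_scaleA cech_scale1 cech_scaleDr cech_scaleDl.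

Lemma cechP (c e : C) : (forall s, c s = e s) -> c = e.
Proof. by move=> h; apply/functional_extensionality_dep. Qed.

Lemma cechD (c e : C) s : (c + e) s = c s + e s. Proof. by []. Qed.
Lemma cechN (c : C) s : (- c) s = - c s. Proof. by []. Qed.
Lemma cechZ a (c : C) s : (a *: c) s = a *: c s. Proof. by []. Qed.

(* Every cochain has this form, with a common exponent in all denominators. *)
Definition frc (v : {set 'I_n} -> M) (k : nat) : C := fun s => frac (yp s) (v s) k.

Lemma frc_raise v k t : frc (fun s => yp s ^+ t *: v s) (k + t) = frc v k.
Proof. by apply: cechP => s; apply: frac_raise. Qed.

Lemma cech_frc (c : C) : exists v k, c = frc v k.
Proof.
have [v /choice[k vk]] := choice (fun s => fracW (c s)).
exists (fun s => yp s ^+ (\max_s k s - k s) *: v s), (\max_s k s)%N.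
apply: cechP => s; rewrite /frc vk -(frac_raise _ _ _ (\max_s k s - k s)).
by rewrite subnKC ?leq_bigmax.
Qed.

Lemma frc_eq0 v k : frc v k = 0 <-> exists t, forall s, yp s ^+ t *: v s = 0.
Proof.
split=> [e0|[t tE]]; last by apply: cechP => s; apply/frac_eq0; exists t.
have h s : exists t, yp s ^+ t *: v s = 0.
  by apply/(frac_eq0 _ _ k); rewrite -[LHS]/(frc v k s) e0.
have [t tE] := choice h; exists (\max_s t s)%N => s.
have -> : (\max_s t s = (\max_s t s - t s) + t s)%N by rewrite subnK ?leq_bigmax.
by rewrite exprD -scalerA tE scaler0.
Qed.

Lemma frcD v w k : frc (fun s => v s + w s) k = frc v k + frc w k.
Proof. by apply: cechP => s; apply: fracD. Qed.
Lemma frcZ a v k : frc (fun s => a *: v s) k = a *: frc v k.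
Proof. by apply: cechP => s; apply: fracZ. Qed.

Definition sgn (j : 'I_n) (s : {set 'I_n}) : R :=
  (-1) ^+ #|[set k in s | (k < j)%N]|.

(** The Cech differential on numerators: the factor [y j ^+ k] passes from the denominator of
    [s :\ j] to that of [s]. Identities for [dv] hold in [M] itself, before localizing. *)
Definition dv (k : nat) (v : {set 'I_n} -> M) (s : {set 'I_n}) : M :=
  \sum_(j in s) sgn j s *: (y j ^+ k *: v (s :\ j)).

Lemma yprodD1 j (s : {set 'I_n}) : j \in s -> yp s = yp (s :\ j) * y j.
Proof. by move=> js; rewrite /yprod (big_setD1 j) //= mulrC. Qed.

Lemma cech_d_frc v k : cech_d (frc v k) = frc (dv k v) k.
Proof.
apply: cechP => s; rewrite /frc /dv frac_sum; apply: eq_bigr => j js.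
by rewrite fracZ (loc_mapE _ _ (yprodD1 js)).
Qed.

Lemma sgn_sgn j s : sgn j s * sgn j s = 1.
Proof. by rewrite /sgn -exprD addnn -mul2n exprM sqrrN !expr1n. Qed.

Lemma sgn_swap (j l : 'I_n) (s : {set 'I_n}) : j \in s -> l \in s -> j != l ->
  sgn j s * sgn l (s :\ j) = - (sgn l s * sgn j (s :\ l)).
Proof.
wlog lj : j l / (l < j)%N.
  move=> W js ls jl; have [lj|jl'|/val_inj e] := ltngtP l j; first exact: W.
    by rewrite (W l j) ?opprK // eq_sym.
  by rewrite e eqxx in jl.
move=> js ls jl.
have -> : sgn l (s :\ j) = sgn l s.
  rewrite /sgn; congr (_ ^+ #|pred_of_set _|); apply/setP => k; rewrite !inE.
  by case: eqP => //= ->; rewrite [(j < l)%N]ltnNge ltnW // andbF.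
suff -> : sgn j s = - sgn j (s :\ l) by rewrite mulNr mulrC.
rewrite /sgn (cardsD1 l [set k in s | (k < j)%N]) !inE ls lj /= exprS mulN1r.
congr (- (_ ^+ #|pred_of_set _|)); apply/setP => k; rewrite !inE.
by rewrite andbA.
Qed.

Lemma dv_dv k v s : dv k (dv k v) s = 0.
Proof.
pose T j l : M := (sgn j s * sgn l (s :\ j)) *:
  ((y j ^+ k * y l ^+ k) *: v (s :\: [set j; l])).
have TE j l : j \in s -> l \in s -> j != l -> T j l = - T l j.
  move=> js ls jl; rewrite /T sgn_swap // scaleNr; congr (- (_ *: _)).
  by rewrite mulrC setUC.
have -> : dv k (dv k v) s =
    \sum_(j in s) \sum_(l in s :\ j) T j l.
  apply: eq_bigr => j js; rewrite /dv !scaler_sumr; apply: eq_bigr => l ls.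
  rewrite /T !scalerA setDDl; congr (_ *: _); ring.
have -> : \sum_(j in s) \sum_(l in s :\ j) T j l =
    \sum_(p | [&& p.1 \in s, p.2 \in s & p.2 != p.1]) T p.1 p.2.
  rewrite pair_big_dep; apply: eq_bigl => -[j l] /=; rewrite !inE.
  by rewrite [(l != j) && _]andbC.
(* The terms at [(j, l)] and [(l, j)] cancel by [TE]. *)
rewrite (bigID (fun p : 'I_n * 'I_n => p.1 < p.2)%N) /=.
rewrite [X in _ + X](reindex (fun p : 'I_n * 'I_n => (p.2, p.1))) /=; last first.
  by exists (fun p : 'I_n * 'I_n => (p.2, p.1)) => -[].
rewrite [X in _ + X](eq_bigl (fun p : 'I_n * 'I_n => [&& p.1 \in s, p.2 \in s & p.2 != p.1]
    && (p.1 < p.2)%N)); last first.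
  move=> [j l] /=; case: (j \in s); case: (l \in s) => //=.
  rewrite -leqNgt -!val_eqE /=; by case: (ltngtP j l).
rewrite -big_split big1 //= => -[j l] /= /andP[/and3P[js ls lj] _].
by rewrite TE // 1?eq_sym // addNr.
Qed.

Lemma cech_d_d (c : C) : cech_d (cech_d c) = 0.
Proof.
have [v [k ->]] := cech_frc c; rewrite !cech_d_frc.
by apply: cechP => s; rewrite /frc dv_dv frac0.
Qed.

Lemma cech_dD (c e : C) : cech_d (c + e) = cech_d c + cech_d e.
Proof.
have [v [k ->]] := cech_frc c; have [w [l ->]] := cech_frc e.
rewrite -(frc_raise v k l) -(frc_raise w l k) addnC -frcD !cech_d_frc -frcD.
congr frc; apply/funext => s; rewrite /dv -big_split; apply: eq_bigr => j _ /=.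
by rewrite !scalerDr.
Qed.

Lemma cech_dZ a (c : C) : cech_d (a *: c) = a *: cech_d c.
Proof.
have [v [k ->]] := cech_frc c; rewrite -frcZ !cech_d_frc -frcZ.
congr frc; apply/funext => s; rewrite /dv scaler_sumr; apply: eq_bigr => j _.
by rewrite !scalerA; congr (_ *: _); ring.
Qed.

Lemma cech_d0 : cech_d (0 : C) = 0.
Proof. by rewrite -(scale0r (0 : C)) cech_dZ !scale0r. Qed.

Lemma cech_dB (c e : C) : cech_d (c - e) = cech_d c - cech_d e.
Proof. by rewrite -scaleN1r cech_dD cech_dZ scaleN1r. Qed.

Lemma cech_deg_submod i : submod (@cech_deg R M n y i).
Proof.
split=> [s _|c e ci ei s si|a c _ ci s si]; first by [].
  by rewrite cechD cechN ci // ei // subrr.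
by rewrite cechZ ci // scaler0.
Qed.

Lemma cech_deg_d i (c : C) : cech_deg i c -> cech_deg i.+1 (cech_d c).
Proof.
move=> ci s si; apply: big1 => j js.
have : c (s :\ j) = 0 by apply: ci => e'; apply: si; rewrite (cardsD1 j) js e'.
move=> ->; rewrite -(frac0 M (yp (s :\ j)) 0%N).
by rewrite (loc_mapE _ _ (yprodD1 js)) !(scaler0, frac0).
Qed.

Lemma cocycleE i (c : C) : cocycle i c <-> cech_deg i c /\ cech_d c = 0.
Proof.
by split=> -[ci dc]; split=> //; [apply: cechP|move=> s; rewrite dc].
Qed.

Lemma coboundaryE i (c : C) :
  coboundary i.+1 c <-> exists2 b, cech_deg i b & c = cech_d b.
Proof.
split=> [[b bi cb]|[b bi ->]]; exists b => //.
- by move=> s si; apply: bi => -[].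
- exact: cechP.
- by move=> s si; apply: bi => e; apply: si; rewrite e.
Qed.

Lemma coboundary0E (c : C) : coboundary 0 c <-> c = 0.
Proof.
split=> [[b b0 cb]|->].
  have e : b = 0 by apply: cechP => s; apply: b0.
  by rewrite -cech_d0 -e; apply: cechP.
by exists 0 => // s; rewrite cech_d0.
Qed.

Lemma cocycle_submod i : submod (@cocycle R M n y i).
Proof.
have [h0 hB hZ] := cech_deg_submod i; split.
- by apply/cocycleE; split=> //; apply: cech_d0.
- move=> c e /cocycleE[ci dc] /cocycleE[ei de]; apply/cocycleE; split.
    exact: hB.
  by rewrite cech_dB dc de subrr.
- move=> a c _ /cocycleE[ci dc]; apply/cocycleE; split; first exact: hZ.
  by rewrite cech_dZ dc scaler0.
Qed.

Lemma coboundary_submod i : submod (@coboundary R M n y i).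
Proof.
case: i => [|i].
  split; first exact/coboundary0E.
    by move=> c e /coboundary0E -> /coboundary0E ->; apply/coboundary0E; rewrite subrr.
  by move=> a c _ /coboundary0E ->; apply/coboundary0E; rewrite scaler0.
have [h0 hB hZ] := cech_deg_submod i; split.
- by apply/coboundaryE; exists 0 => //; rewrite cech_d0.
- move=> _ _ /coboundaryE[b bi ->] /coboundaryE[b' bi' ->]; apply/coboundaryE.
  by exists (b - b'); [exact: hB|rewrite cech_dB].
- move=> a _ _ /coboundaryE[b bi ->]; apply/coboundaryE.
  by exists (a *: b); [exact: hZ|rewrite cech_dZ].
Qed.

Lemma coboundary_cocycle i : ple (@coboundary R M n y i) (cocycle i).
Proof.
case: i => [|i] c.
  by move/coboundary0E ->; apply: osub0 (cocycle_submod 0).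
move/coboundaryE => [b bi ->]; apply/cocycleE.
by split; [apply: cech_deg_d|apply: cech_d_d].
Qed.

(** The numerators of the differential are killed by a common power of the [yp s]; expanding the
    fractions by that power makes the cocycle condition hold in [M]. *)
Lemma cocycle_frc i (c : C) : cocycle i c -> exists v k, [/\ c = frc v k,
  forall s, dv k v s = 0 & forall s : {set 'I_n}, #|s| <> i -> v s = 0].
Proof.
case/cocycleE; have [v' [k ->]] := cech_frc c => ci.
pose v (s : {set 'I_n}) := if #|s| == i then v' s else 0.
have -> : frc v' k = frc v k.
  apply: cechP => s; rewrite /frc /v; case: eqP => // /ci; rewrite /frc => ->.
  by rewrite frac0.
rewrite cech_d_frc => /frc_eq0[t tE].
exists (fun s => yp s ^+ t *: v s), (k + t)%N; split.
- by rewrite frc_raise.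
- move=> s; rewrite -[RHS](tE s) /dv scaler_sumr; apply: eq_bigr => j js.
  by rewrite !scalerA (yprodD1 js) exprMn exprD; congr (_ *: _); ring.
- by move=> s /eqP/negPf si; rewrite /v si scaler0.
Qed.

(* The contracting homotopy of the localization at [y j]. *)
Lemma cocycle_torsion i (c : C) j : cocycle i c ->
  exists N, coboundary i (y j ^+ N *: c).
Proof.
move=> /cocycle_frc[v [k [-> v0 vi]]]; exists k.
(* With this sign [dv k b] equals [y j ^+ k *: v] exactly, so the exponent [k] of the denominators
   suffices as [N]. *)
pose b (s : {set 'I_n}) : M := if j \in s then 0 else sgn j (j |: s) *: v (j |: s).
have bd s : dv k b s = y j ^+ k *: v s.
  have [js|js] := boolP (j \in s).
    rewrite /dv (bigD1 j) //= big1 ?addr0 => [|l /andP[ls lj]].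
      by rewrite /b setD11 setD1K // !scalerA mulrAC sgn_sgn mul1r.
    by rewrite /b in_setD1 eq_sym lj js !scaler0.
  have := v0 (j |: s); rewrite /dv (big_setU1 _ js) /= setU1K // => /eqP.
  rewrite addr_eq0 => /eqP /(congr1 (fun u => sgn j (j |: s) *: u)).
  rewrite scalerA sgn_sgn scale1r => ->; rewrite scalerN scaler_sumr -sumrN.
  apply: eq_bigr => l ls; have lj : l != j by apply: contraNneq js => <-.
  rewrite /b in_setD1 (negPf js) andbF !scalerA.
  have -> : j |: (s :\ l) = (j |: s) :\ l.
    by apply/setP => x; rewrite !inE; case: eqP => // ->; rewrite eq_sym lj.
  rewrite -scaleNr; congr (_ *: _).
  have jl : j != l by rewrite eq_sym.
  have := sgn_swap (setU11 j s) (setU1r j ls) jl; rewrite setU1K // => sw.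
  have -> : sgn l s = - (sgn j (j |: s) * sgn l (j |: s) * sgn j ((j |: s) :\ l)).
    by rewrite -mulrA -mulrN -sw mulrA sgn_sgn mul1r.
  by rewrite -[RHS]mulr1 -(sgn_sgn j ((j |: s) :\ l)); ring.
case: i vi => [|i] vi.
  apply/coboundary0E; apply: cechP => s; rewrite cechZ /frc -fracZ -bd.
  rewrite /dv big1 ?frac0 // => l ls; rewrite /b.
  case: ifP => _; first by rewrite !scaler0.
  by rewrite vi ?scaler0 // => /eqP; rewrite cards_eq0 -subset0 subUset sub1set inE.
apply/coboundaryE; exists (frc b k).
  move=> s si; rewrite /frc /b; case: ifPn => js; first by rewrite frac0.
  by rewrite vi ?scaler0 ?frac0 // cardsU1 js => -[].
by rewrite cech_d_frc -frcZ; congr frc; apply/funext => s; rewrite bd.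
Qed.

End CechModule.

(** * Functoriality of Cech cohomology *)

Section CechMap.
Variables (R : comNzRingType) (n : nat) (y : 'I_n -> R).

(* Weaker than [R]-linear, so as to cover maps that are only [K[y]]-linear. *)
Definition ysemilinear (M N : lmodType R) (phi : M -> N) : Prop :=
  {morph phi : u v / u + v} /\ forall j v, phi (y j *: v) = y j *: phi v.

(** Computed on chosen representatives; [cmap_frc] shows independence of the choice when [phi]
    commutes with the [y j]. *)
Definition cmap (M N : lmodType R) (phi : M -> N) (c : cech M y) : cech N y :=
  fun s => frac (yprod y s) (phi (repr (c s)).1) (repr (c s)).2.

Section Semilinear.
Variables (M N : lmodType R) (phi : M -> N).
Hypothesis hphi : ysemilinear phi.

Lemma ysl0 : phi 0 = 0.
Proof. by apply: (@addrI _ (phi 0)); rewrite -hphi.1 !addr0. Qed.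
Lemma yslN v : phi (- v) = - phi v.
Proof. by apply: (@addrI _ (phi v)); rewrite -hphi.1 !subrr ysl0. Qed.
Lemma ysl_sign k v : phi ((-1) ^+ k *: v) = (-1) ^+ k *: phi v.
Proof. by rewrite -signr_odd; case: odd; rewrite ?scale1r // !scaleN1r yslN. Qed.
Lemma ysl_sum (I : Type) (r : seq I) (P : pred I) (F : I -> M) :
  phi (\sum_(i <- r | P i) F i) = \sum_(i <- r | P i) phi (F i).
Proof. exact: (big_morph phi hphi.1 ysl0). Qed.
Lemma yslX j k v : phi (y j ^+ k *: v) = y j ^+ k *: phi v.
Proof.
elim: k => [|k IH] in v *; first by rewrite !scale1r.
by rewrite exprSr -!scalerA IH hphi.2.
Qed.
Lemma ysl_yprod s v : phi (yprod y s *: v) = yprod y s *: phi v.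
Proof.
rewrite /yprod; elim/big_rec: _ v => [|j p _ IH] v; first by rewrite !scale1r.
by rewrite -!scalerA hphi.2 IH.
Qed.
Lemma ysl_yprodX s t v : phi (yprod y s ^+ t *: v) = yprod y s ^+ t *: phi v.
Proof.
elim: t => [|t IH] in v *; first by rewrite !scale1r.
by rewrite exprSr -!scalerA IH ysl_yprod.
Qed.

Lemma cmap_frc (v : {set 'I_n} -> M) k :
  cmap phi (frc y v k) = frc y (fun s => phi (v s)) k.
Proof.
apply: cechP => s; rewrite /cmap /frc.
set a := repr _; have /fracP[t tE] : frac (yprod y s) a.1 a.2 = frac (yprod y s) (v s) k.
  by rewrite frac_repr.
by apply/fracP; exists t; rewrite -!ysl_yprodX tE.
Qed.

Lemma cmapD c e : cmap phi (c + e) = cmap phi c + cmap phi e.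
Proof.
have [v [k ->]] := cech_frc c; have [w [l ->]] := cech_frc e.
rewrite -(frc_raise _ v k l) -(frc_raise _ w l k) addnC -frcD !cmap_frc -frcD.
by congr frc; apply/funext => s; rewrite hphi.1.
Qed.

Lemma cmap0 : cmap phi 0 = 0.
Proof. by apply: (@addrI _ (cmap phi 0)); rewrite -cmapD !addr0. Qed.

Lemma cmapB c e : cmap phi (c - e) = cmap phi c - cmap phi e.
Proof.
by apply: (@addIr _ (cmap phi e)); rewrite -cmapD !subrK.
Qed.

Lemma cmap_d c : cmap phi (cech_d c) = cech_d (cmap phi c).
Proof.
have [v [k ->]] := cech_frc c; rewrite !(cech_d_frc, cmap_frc).
congr frc; apply/funext => s; rewrite /dv ysl_sum; apply: eq_bigr => j _.
by rewrite /sgn ysl_sign yslX.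
Qed.

Lemma cmap_deg i c : cech_deg i c -> cech_deg i (cmap phi c).
Proof.
move=> ci s si; have [v [k e]] := cech_frc c.
rewrite e cmap_frc; apply/frac_eq0.
have /frac_eq0[t tE] : frac (yprod y s) (v s) k = 0.
  by have := ci s si; rewrite e.
by exists t; rewrite -ysl_yprodX tE ysl0.
Qed.

Lemma cmap_cocycle i c : cocycle i c -> cocycle i (cmap phi c).
Proof.
move=> /cocycleE[ci dc]; apply/cocycleE; split; first exact: cmap_deg.
by rewrite -cmap_d dc cmap0.
Qed.

Lemma cmap_coboundary i c : coboundary i c -> coboundary i (cmap phi c).
Proof.
case: i => [|i]; first by move/coboundary0E ->; rewrite cmap0; apply/coboundary0E.
move=> /coboundaryE[b bi ->]; apply/coboundaryE; exists (cmap phi b).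
  exact: cmap_deg.
by rewrite cmap_d.
Qed.

Lemma cmap_lift i c : (forall w, exists v, phi v = w) -> cech_deg i c ->
  exists2 b, cech_deg i b & cmap phi b = c.
Proof.
move=> surj ci; have [w [k e]] := cech_frc c.
have [v vw] := choice (fun s => surj (w s)).
exists (frc y (fun s => if #|s| == i then v s else 0) k).
  by move=> s /eqP/negPf si; rewrite /frc si frac0.
rewrite cmap_frc; apply: cechP => s; rewrite /frc; case: eqP => [_|si].
  by rewrite vw e.
by rewrite ysl0 frac0 ci.
Qed.

End Semilinear.

Lemma linear_ysl (M N : lmodType R) (g : {linear M -> N}) : ysemilinear g.
Proof. by split=> [u v|j v]; rewrite ?linearD ?linearZ. Qed.

Lemma cmapZ (M N : lmodType R) (g : {linear M -> N}) a (c : cech M y) :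
  cmap g (a *: c) = a *: cmap g c.
Proof.
have [v [k ->]] := cech_frc c; rewrite -frcZ !(cmap_frc (linear_ysl g)) -frcZ.
by congr frc; apply/funext => s; rewrite linearZ.
Qed.

(** A cocycle of [W] is the image under [pi] of a cocycle of [M], which is a coboundary. This will
    be applied to a splitting over [K[y]]. *)
Lemma lc_zero_retract (M W : lmodType R) (sigma : W -> M) (pi : M -> W) i :
  ysemilinear sigma -> ysemilinear pi -> cancel sigma pi ->
  lc_zero M y i -> lc_zero W y i.
Proof.
move=> hs hp sK M0 c ci.
have -> : c = cmap pi (cmap sigma c).
  have [v [k ->]] := cech_frc c; rewrite (cmap_frc hs) (cmap_frc hp).
  by congr frc; apply/funext => s; rewrite sK.
by apply: cmap_coboundary hp _ _ _; apply/M0/cmap_cocycle.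
Qed.

(** As there are finitely many [y j], this means that some power of the ideal they generate kills
    [v]. *)
Definition ytorsion (M : lmodType R) (v : M) : Prop :=
  forall j, exists N, y j ^+ N *: v = 0.

Section TorsionKernel.
Variables (A B : lmodType R) (g : {linear A -> B}).
Hypothesis surj : forall w, exists v, g v = w.
Hypothesis ker : forall v, g v = 0 -> ytorsion v.

(** In positive degree [s] contains some [j], and localizing at [yprod y s] kills everything that is
    torsion for [y j]. *)
Lemma cmap_torsion_inj i (c : cech A y) :
  cech_deg i.+1 c -> cmap g c = 0 -> c = 0.
Proof.
move=> ci; have [v [k e]] := cech_frc c; rewrite {1}e (cmap_frc (linear_ysl g)).
move=> /frc_eq0[t tE]; apply: cechP => s.
have [si|si] := eqVneq #|s| i.+1; last by apply: ci; apply/eqP.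
have [j js] : exists j, j \in s by apply/set0Pn; rewrite -card_gt0 si.
rewrite e /frc; apply/frac_eq0.
have [|N NE] := ker (v := yprod y s ^+ t *: v s) _ j.
  by rewrite linearZ /= tE.
exists (N + t)%N; rewrite exprD -scalerA (yprodD1 _ js) exprMn -scalerA.
by rewrite -(yprodD1 _ js) NE scaler0.
Qed.

Lemma coboundary_torsion_ker i (c : cech A y) : cech_deg i.+1 c ->
  coboundary i.+1 (cmap g c) -> coboundary i.+1 c.
Proof.
move=> ci /coboundaryE[b bi e]; have hg := linear_ysl g.
have [a ai eb] := cmap_lift hg surj bi.
apply/coboundaryE; exists a => //; apply/eqP; rewrite -subr_eq0; apply/eqP.
apply: (@cmap_torsion_inj i); last by rewrite (cmapB hg) (cmap_d hg) eb e subrr.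
by apply: (osubB (cech_deg_submod _ _ _)) => //; apply: cech_deg_d.
Qed.

Lemma cocycle_torsion_lift i (c : cech B y) : cocycle i.+1 c ->
  exists2 a, cocycle i.+1 a & cmap g a = c.
Proof.
move=> /cocycleE[ci dc]; have hg := linear_ysl g.
have [a ai ea] := cmap_lift hg surj ci; exists a => //.
apply/cocycleE; split=> //; apply: (@cmap_torsion_inj i.+1).
  exact: cech_deg_d.
by rewrite (cmap_d hg) ea.
Qed.

Lemma lc_zero_torsion_iff i : lc_zero A y i.+1 <-> lc_zero B y i.+1.
Proof.
have hg := linear_ysl g; split=> H0 c hc.
  have [a ha <-] := cocycle_torsion_lift hc.
  exact/(cmap_coboundary hg)/H0.
have /cocycleE[ci _] := hc.
by apply: coboundary_torsion_ker => //; apply/H0/cmap_cocycle.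
Qed.

End TorsionKernel.

Lemma lc_zero_torsion (M : lmodType R) i :
  (forall v : M, ytorsion v) -> lc_zero M y i.+1.
Proof.
move=> tors c /cocycleE[ci _].
suff -> : c = 0 by apply: osub0 (coboundary_submod M y i.+1).
have [v [k e]] := cech_frc c; apply: cechP => s.
have [si|si] := eqVneq #|s| i.+1; last by apply: ci; apply/eqP.
have [j js] : exists j, j \in s by apply/set0Pn; rewrite -card_gt0 si.
rewrite e /frc; apply/frac_eq0; have [N NE] := tors (v s) j.
by exists N; rewrite (yprodD1 _ js) exprMn -scalerA NE scaler0.
Qed.

(** A cochain of degree 0 is an element of [M] placed at the empty set, where the denominator is 1.
    It is a cocycle when it vanishes in every localization at a [y j], that is, when it is
    torsion. *)
Lemma lc_zero0P (M : lmodType R) :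
  lc_zero M y 0 <-> forall v : M, ytorsion v -> v = 0.
Proof.
split=> [M0 v tv|tors0 c].
  pose w (s : {set 'I_n}) := if s == set0 then v else 0.
  have [N NE] := choice tv.
  have cw : cocycle 0 (frc y w 0).
    apply/cocycleE; split.
      by move=> s /eqP; rewrite cards_eq0 /frc /w => /negPf ->; rewrite frac0.
    rewrite cech_d_frc; apply/frc_eq0; exists (\max_j N j)%N => s.
    rewrite /dv scaler_sumr; apply: big1 => j js.
    rewrite /w; case: eqP => [sj|_]; last by rewrite !scaler0.
    rewrite (yprodD1 _ js) sj expr0 scale1r scalerA mulrC -scalerA exprMn.
    rewrite -scalerA -(subnK (leq_bigmax (F := N) j)) [y j ^+ _]exprD.
    by rewrite -[(_ * _) *: v]scalerA NE !scaler0.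
  have /coboundary0E/frc_eq0[t /(_ set0)] := M0 _ cw.
  by rewrite /w eqxx /yprod big_set0 expr1n scale1r.
move=> /cocycle_frc[v [k [-> v0 vi]]]; apply/coboundary0E.
apply: cechP => s; have [->|s0] := eqVneq s set0; last first.
  by rewrite /frc vi ?frac0 //; apply/eqP; rewrite cards_eq0.
rewrite /frc (tors0 (v set0)) ?frac0 // => j; exists k.
have := v0 [set j]; rewrite /dv big_set1 setDv => /(congr1 (fun u => sgn R j [set j] *: u)).
by rewrite scalerA sgn_sgn scale1r scaler0.
Qed.

(** * The long exact sequence of multiplication by a regular element *)

Section RegularElement.
Variables (M N : lmodType R) (z : R) (g : {linear M -> N}).
Hypothesis reg : regular_on M z.
Hypothesis surj : forall w, exists v, g v = w.
Hypothesis ker : forall v, g v = 0 <-> exists u, v = z *: u.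

Let hg := linear_ysl g.

Lemma cech_regular (c : cech M y) : z *: c = 0 -> c = 0.
Proof.
have [v [k ->]] := cech_frc c; rewrite -frcZ => /frc_eq0[t tE].
by apply/frc_eq0; exists t => s; apply: reg; rewrite scalerA mulrC -scalerA.
Qed.

Lemma cech_deg_regular i (c : cech M y) : cech_deg i (z *: c) -> cech_deg i c.
Proof.
move=> ci s si; have [v [k e]] := cech_frc c.
have := ci s si; rewrite cechZ e -fracZ => /frac_eq0[t tE].
by apply/frac_eq0; exists t; apply: reg; rewrite scalerA mulrC -scalerA.
Qed.

Lemma cmap_ker (c : cech M y) : cmap g c = 0 -> exists c', c = z *: c'.
Proof.
have [v [k ->]] := cech_frc c; rewrite (cmap_frc hg) => /frc_eq0[t tE].
have h s : exists u, yprod y s ^+ t *: v s = z *: u.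
  by apply/ker; rewrite linearZ /= tE.
have [u uE] := choice h; exists (frc y u (k + t)).
by rewrite -frcZ -(frc_raise _ _ _ t); congr frc; apply/funext => s.
Qed.

Lemma cmap_z (c : cech M y) : cmap g (z *: c) = 0.
Proof.
have [v [k ->]] := cech_frc c; rewrite -frcZ (cmap_frc hg); apply/frc_eq0.
by exists 0%N => s; rewrite (ker _).2 ?scaler0 //; exists (v s).
Qed.

(** The kernel of [z] on [H^(i+1)(M)] is the image of [H^i(N)] under the connecting map. *)
Lemma coboundary_regular i (c : cech M y) : lc_zero N y i -> cocycle i.+1 c ->
  coboundary i.+1 (z *: c) -> coboundary i.+1 c.
Proof.
move=> N0 /cocycleE[ci dc] /coboundaryE[b bi zc].
have gbB : coboundary i (cmap g b).
  apply/N0/cocycleE; split; first exact: cmap_deg.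
  by rewrite -(cmap_d hg) -zc cmap_z.
(* Changing the primitive [b] by a coboundary makes it vanish in [N], hence divisible by [z]. For
   [i = 0] its image is already zero. *)
have [b1 [b1i db1 gb1]] : exists b1, [/\ cech_deg i b1,
    cech_d b1 = cech_d b & cmap g b1 = 0].
  case: i b bi gbB {N0 c ci dc zc} => [|i] b bi.
    by move/coboundary0E => gb; exists b.
  move/coboundaryE => [a ai ea]; have [a' ai' ea'] := cmap_lift hg surj ai.
  exists (b - cech_d a'); split.
  - by apply: (osubB (cech_deg_submod _ _ _)) => //; apply: cech_deg_d.
  - by rewrite cech_dB cech_d_d subr0.
  - by rewrite (cmapB hg) (cmap_d hg) ea' ea subrr.
have [b' eb'] := cmap_ker gb1; apply/coboundaryE; exists b'.
  by apply: cech_deg_regular; rewrite -eb'.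
apply/eqP; rewrite -subr_eq0; apply/eqP/cech_regular.
by rewrite scalerBr zc -db1 eb' cech_dZ subrr.
Qed.

(** The differential of any cochain lift is [z] times a cocycle, whose class is the connecting image
    of [c]. A primitive of this cocycle, times [z], corrects the lift. *)
Lemma cocycle_lift i (c : cech N y) : lc_zero M y i.+1 -> cocycle i c ->
  exists2 b : cech M y, cocycle i b & cmap g b = c.
Proof.
move=> M0 /cocycleE[ci dc]; have [b bi eb] := cmap_lift hg surj ci.
have [|a ea] := @cmap_ker (cech_d b); first by rewrite (cmap_d hg) eb.
have /M0/coboundaryE[b' bi' eb'] : cocycle i.+1 a.
  apply/cocycleE; split.
    by apply: cech_deg_regular; rewrite -ea; apply: cech_deg_d.
  by apply: cech_regular; rewrite -cech_dZ -ea cech_d_d.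
exists (b - z *: b'); last by rewrite (cmapB hg) cmap_z subr0.
apply/cocycleE; split.
  apply: (osubB (cech_deg_submod _ _ _)) => //.
  exact: (submodZ (cech_deg_submod _ _ _)).
by rewrite cech_dB cech_dZ ea eb' subrr.
Qed.

(** Every class of [N] lifts to [M]; there it is a multiple of [z], which dies in [N]. *)
Lemma lc_zero_quotient i : lc_zero M y i.+1 ->
  (forall c : cech M y, cocycle i c ->
    exists a b, [/\ cocycle i a, coboundary i b & c = z *: a + b]) ->
  lc_zero N y i.
Proof.
move=> M0 div c ci; have [b hb <-] := cocycle_lift M0 ci.
have [a [b' [_ hb' ->]]] := div b hb.
by rewrite (cmapD hg) cmap_z add0r; apply: cmap_coboundary.
Qed.

(* The connecting map sends the cocycles of [N] onto the cocycles of [M] that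
   [z] maps to coboundaries. *)
Lemma dcc_connecting i :
  dcc (@cocycle R N n y i) (coboundary i) ->
  dcc (fun c : cech M y => cocycle i.+1 c /\ coboundary i.+1 (z *: c))
      (coboundary i.+1).
Proof.
move=> dN E hE EE.
(* [F k] is the preimage of [E k] under the connecting map. *)
pose F k c := cocycle i c /\ exists b e,
  [/\ cech_deg i b, cmap g b = c, E k e & cech_d b = z *: e].
have degB := osubB (cech_deg_submod M y i).
have [||k kP] := dN F.
- move=> k; have [hEk BE EZ] := hE k; split; last by move=> c [].
    split.
    + split; first exact: osub0 (cocycle_submod _ _ _).
      exists 0, 0; rewrite (cmap0 hg) cech_d0 scaler0; split=> //.
      exact: osub0 hEk.
    + move=> u v [hu [b [e [bi bu Ee be]]]] [hv [b' [e' [bi' bv Ee' be']]]].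
      split; first exact: (osubB (cocycle_submod _ _ _)).
      exists (b - b'), (e - e'); split.
      * exact: degB.
      * by rewrite (cmapB hg) bu bv.
      * exact: (osubB hEk).
      * by rewrite cech_dB be be' scalerBr.
    + move=> a u _ [hu [b [e [bi bu Ee be]]]].
      split; first exact: (submodZ (cocycle_submod _ _ _)).
      exists (a *: b), (a *: e); split.
      * exact: (submodZ (cech_deg_submod _ _ _)).
      * by rewrite cmapZ bu.
      * exact: submodZ.
      * by rewrite cech_dZ be !scalerA mulrC.
  move=> c hc; split; first exact: coboundary_cocycle.
  have [b [bi db gb]] : exists b : cech M y,
      [/\ cech_deg i b, cech_d b = 0 & cmap g b = c].
    case: i c hc {F degB dN E hE EE k hEk BE EZ} => [|i] c.
      by move/coboundary0E ->; exists 0; rewrite cech_d0 (cmap0 hg).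
    move/coboundaryE => [a ai ->]; have [a' ai' <-] := cmap_lift hg surj ai.
    exists (cech_d a'); split; [exact: cech_deg_d|exact: cech_d_d|].
    by rewrite (cmap_d hg).
  by exists b, 0; split=> //; [apply: osub0 hEk|rewrite db scaler0].
- move=> k c [hc [b [e [bi bc Ee be]]]]; split=> //; exists b, e; split=> //.
  exact: EE Ee.
exists k => j kj e Ee; have [hEj BE _] := hE j; have [_ _ EZ] := hE k.
have [/cocycleE[ei de] /coboundaryE[b bi zb]] := EZ e Ee.
have [|_ [b' [e' [bi' gb' Ee' be']]]] := kP j kj (cmap g b).
  split; last by exists b, e.
  apply/cocycleE; split; first exact: cmap_deg.
  by rewrite -(cmap_d hg) -zb cmap_z.
have [|u ue] := @cmap_ker (b - b'); first by rewrite (cmapB hg) gb' subrr.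
rewrite -[e](subrK e'); apply: (osubD hEj) => //; apply: BE.
apply/coboundaryE; exists u; first by apply: cech_deg_regular; rewrite -ue; apply: degB.
apply/eqP; rewrite -subr_eq0; apply/eqP/cech_regular.
by rewrite !scalerBr zb -be' -cech_dZ -ue cech_dB subrr.
Qed.

End RegularElement.
End CechMap.

(** * Melkersson's criterion for artinian modules *)

Section Melkersson.
Variables (R : comNzRingType) (C : lmodType R) (Z B : C -> Prop).
Hypotheses (hZ : submod Z) (hB : submod B) (BZ : ple B Z).

(* [F j k] is [z ^+ k] times the part of [E j] killed by [z ^+ k.+1] modulo [B]. *)
Lemma dcc_power_torsion z : (forall c, Z c -> exists N, B (z ^+ N *: c)) ->
  dcc (fun c => Z c /\ B (z *: c)) B -> dcc Z B.
Proof.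
move=> tors dz E hE EE.
pose F j k c := exists e b, [/\ E j e, B (z ^+ k.+1 *: e), B b & c = z ^+ k *: e + b].
have [|||J JP] := double_chain (@pge_refl C) (@pge_trans C) (F := F) dz.
- move=> j k; have [hEj BE EZ] := hE j; split.
  + split.
    * exists 0, 0; rewrite !scaler0 addr0.
      by split=> //; [exact: osub0 hEj|exact: osub0 hB|exact: osub0 hB].
    * move=> _ _ [e [b [Ee ke Bb ->]]] [e' [b' [Ee' ke' Bb' ->]]].
      exists (e - e'), (b - b'); split.
      - exact: (osubB hEj).
      - by rewrite scalerBr; apply: (osubB hB).
      - exact: (osubB hB).
      - by rewrite scalerBr opprD addrACA.
    * move=> a _ _ [e [b [Ee ke Bb ->]]]; exists (a *: e), (a *: b); split.
      - exact: submodZ.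
      - by rewrite scalerA mulrC -scalerA; apply: submodZ.
      - exact: submodZ.
      - by rewrite scalerDr !scalerA mulrC.
  + move=> b Bb; exists 0, b; rewrite !scaler0 add0r.
    by split=> //; [exact: osub0 hEj|exact: osub0 hB].
  + move=> _ [e [b [Ee ke Bb ->]]]; split.
      by apply: (osubD hZ); [apply: submodZ => //; exact: EZ|exact: BZ].
    rewrite scalerDr scalerA -exprS; apply: (osubD hB) => //.
    exact: submodZ.
- move=> j k _ [e [b [Ee ke Bb ->]]]; exists e, b; split=> //; exact: EE Ee.
- move=> j k _ [e [b [Ee ke Bb ->]]]; exists (z *: e), b; split=> //.
  + by apply: submodZ => //; case: (hE j).
  + by rewrite scalerA -exprSr.
  + by rewrite scalerA -exprSr.
have mon := chain_mono (@pge_refl C) (@pge_trans C) EE.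
exists J => j Jj e Ee; have [hEj BE _] := hE j; have [hEJ _ EZ] := hE J.
have [N NE] := tors e (EZ e Ee).
(* Some [e'] in [E j] has the same multiple by [z ^+ N] as [e] modulo [B], so [e - e'] is killed by
   a smaller power. *)
elim: N e Ee NE => [|N IH] e Ee NE.
  by apply: BE; rewrite scale1r in NE.
have [|e' [b [Ee' ke' Bb eE]]] := JP j N Jj (z ^+ N *: e).
  by exists e, 0; rewrite addr0; split=> //; exact: osub0 hB.
rewrite -[e](subrK e'); apply: (osubD hEj) => //; apply: IH.
  by apply: (osubB hEJ) => //; apply: mon Ee'.
by rewrite scalerBr eE addrC addKr.
Qed.

End Melkersson.

(** A module that is torsion for each of finitely many elements is artinian as soon as their common
    annihilator in it is; the elements are treated one after another. *)
Lemma dcc_power_torsion_seq (R : comNzRingType) (C : lmodType R)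
    (Z B : C -> Prop) (zs : seq R) : submod Z -> submod B -> ple B Z ->
  (forall z c, z \in zs -> Z c -> exists N, B (z ^+ N *: c)) ->
  dcc (fun c => Z c /\ forall z, z \in zs -> B (z *: c)) B -> dcc Z B.
Proof.
elim: zs Z => [|z zs IH] Z hZ hB BZ tors dz.
  by apply: chain_cond_sub dz => E [hE BE EZ]; split=> // v /EZ Zv.
have hZz : submod (fun c => Z c /\ B (z *: c)).
  split.
  - by split; [exact: osub0 hZ|rewrite scaler0; exact: osub0 hB].
  - move=> u v [Zu Bu] [Zv Bv]; split; first exact: (osubB hZ).
    by rewrite scalerBr; apply: (osubB hB).
  - move=> a u _ [Zu Bu]; split; first exact: submodZ.
    by rewrite scalerA mulrC -scalerA; apply: submodZ.
apply: (@dcc_power_torsion _ _ _ _ hZ hB BZ z).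
  by move=> c; apply: tors; apply: mem_head.
apply: IH => //.
- by move=> b Bb; split; [exact: BZ|exact: submodZ].
- by move=> z' c z's [Zc _]; apply: tors => //; rewrite in_cons z's orbT.
apply: chain_cond_sub dz => E [hE BE EZ]; split=> // v /EZ[[Zv zv] zsv].
by split=> // z'; rewrite in_cons => /predU1P[->|/zsv].
Qed.

(** * Quotient modules *)

Section QuotientBySubmodule.
Variables (R : comNzRingType) (M : lmodType R).

Record submodule := Submodule { sm_in :> M -> Prop; sm_submod : submod sm_in }.

Variable L : submodule.

Definition smem : {pred M} := fun v => `[< L v >].

Fact smem_zmod_closed : zmod_closed smem.
Proof.
have hL := sm_submod L; split=> [|u v /asboolP Lu /asboolP Lv]; apply/asboolP.
  exact: osub0 hL.
exact: (osubB hL).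
Qed.

HB.instance Definition _ := GRing.isZmodClosed.Build M smem smem_zmod_closed.

Definition qmod : Type := Quotient.quot smem.
HB.instance Definition _ := GRing.Zmodule.on qmod.

Definition to_qmod (v : M) : qmod := \pi_(Quotient.quot smem)%qT v.

Lemma to_qmodP v w : to_qmod v = to_qmod w <-> L (v - w).
Proof.
rewrite /to_qmod; split.
  by move/eqP; rewrite -Quotient.idealrBE => /asboolP.
by move=> vw; apply/eqP; rewrite -Quotient.idealrBE; apply/asboolP.
Qed.

Lemma to_qmodW x : exists v, x = to_qmod v.
Proof. by exists (repr x); rewrite /to_qmod reprK. Qed.

Lemma to_qmodD v w : to_qmod (v + w) = to_qmod v + to_qmod w.
Proof. by rewrite /to_qmod raddfD. Qed.

Definition qmod_scale (r : R) (x : qmod) : qmod := to_qmod (r *: repr x).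

Lemma qmod_scaleE r v : qmod_scale r (to_qmod v) = to_qmod (r *: v).
Proof.
apply/to_qmodP; rewrite -scalerBr; apply: (submodZ (sm_submod L)).
by apply/to_qmodP; rewrite /to_qmod reprK.
Qed.

Fact qmod_scaleA a b x : qmod_scale a (qmod_scale b x) = qmod_scale (a * b) x.
Proof. by have [v ->] := to_qmodW x; rewrite !qmod_scaleE scalerA. Qed.
Fact qmod_scale1 : left_id 1 qmod_scale.
Proof. by move=> x; have [v ->] := to_qmodW x; rewrite qmod_scaleE scale1r. Qed.
Fact qmod_scaleDr : right_distributive qmod_scale +%R.
Proof.
move=> a x w; have [u ->] := to_qmodW x; have [v ->] := to_qmodW w.
by rewrite -to_qmodD !qmod_scaleE scalerDr to_qmodD.
Qed.
Fact qmod_scaleDl x : {morph qmod_scale^~ x : a b / a + b}.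
Proof.
by move=> a b; have [v ->] := to_qmodW x; rewrite !qmod_scaleE scalerDl to_qmodD.
Qed.
HB.instance Definition _ := GRing.Zmodule_isLmodule.Build R qmod
  qmod_scaleA qmod_scale1 qmod_scaleDr qmod_scaleDl.

Fact to_qmod_linear : linear to_qmod.
Proof. by move=> a u v; rewrite to_qmodD -qmod_scaleE. Qed.
HB.instance Definition _ := GRing.isLinear.Build R M qmod _ to_qmod to_qmod_linear.

Lemma to_qmod_eq0 v : to_qmod v = 0 <-> L v.
Proof. by rewrite -(raddf0 to_qmod) to_qmodP subr0. Qed.

End QuotientBySubmodule.

Section QuotzLinear.
Variables (R : comNzRingType) (M : lmodType R) (z : R).

Fact to_quotz_linear : linear (to_quotz (M := M) z).
Proof. by move=> a u v; rewrite to_quotzD -quotz_scaleE. Qed.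
HB.instance Definition _ :=
  GRing.isLinear.Build R M (quotz M z) _ (to_quotz z) to_quotz_linear.

Lemma to_quotz_eq0 (v : M) : to_quotz z v = 0 <-> exists u, v = z *: u.
Proof. by rewrite -(raddf0 (to_quotz z)) to_quotzP subr0. Qed.

Lemma to_quotzW (x : quotz M z) : exists v, to_quotz z v = x.
Proof. by exists (repr x); apply: to_quotz_repr. Qed.

End QuotzLinear.

Lemma fin_gen_surj (R : comNzRingType) (A B : lmodType R) (g : {linear A -> B}) :
  (forall w, exists v, g v = w) -> fin_gen A -> fin_gen B.
Proof.
move=> surj [k [a aP]]; exists k, (fun i => g (a i)) => w.
have [v <-] := surj w; have [c ->] := aP v; exists c.
by rewrite linear_sum; apply: eq_bigr => i _; rewrite linearZ.
Qed.

(** If [g v] equals [z *: g u], then [v - z *: u] lies in the kernel of [g]. So the kernel of the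
    induced map is the image of that kernel, and the two quotients share their cohomology in
    positive degree. *)
Lemma quotz_torsion_map (R : comNzRingType) (n : nat) (y : 'I_n -> R)
    (A B : lmodType R) (g : {linear A -> B}) (z : R) :
  (forall w, exists v, g v = w) -> (forall v, g v = 0 -> ytorsion y v) ->
  exists h : {linear quotz A z -> quotz B z},
    (forall w, exists v, h v = w) /\ (forall v, h v = 0 -> ytorsion y v).
Proof.
move=> surj ker; pose h (x : quotz A z) := to_quotz z (g (repr x)).
have hE v : h (to_quotz z v) = to_quotz z (g v).
  have /to_quotzP[u uE] := to_quotz_repr (to_quotz z v).
  by apply/to_quotzP; exists (g u); rewrite -linearB uE linearZ.
have hlin : linear h.
  move=> a x x'; have [v <-] := to_quotzW x; have [v' <-] := to_quotzW x'.
  by rewrite -linearP !hE !linearP.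
pose H := GRing.isLinear.Build R _ _ _ h hlin.
pose hl : {linear quotz A z -> quotz B z} := HB.pack h H.
exists hl; split=> x.
  have [w <-] := to_quotzW x; have [v <-] := surj w.
  by exists (to_quotz z v); apply: hE.
have [v <-] := to_quotzW x; rewrite [hl _]hE => /to_quotz_eq0[w].
have [u <-] := surj w => e j.
have [|N NE] := ker (v - z *: u) _ j; first by rewrite linearB linearZ /= e subrr.
exists N; rewrite -linearZ; apply/to_quotz_eq0; exists (y j ^+ N *: u).
apply/eqP; rewrite -subr_eq0; apply/eqP; rewrite -[RHS]NE scalerBr.
by rewrite !scalerA mulrC.
Qed.

(** * Removing the torsion of a module *)

Section TorsionQuotient.
Variables (R : comNzRingType) (n : nat) (y : 'I_n -> R) (M : lmodType R).

Lemma expr_kill_le (a : R) (v : M) N N' :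
  (N <= N')%N -> a ^+ N *: v = 0 -> a ^+ N' *: v = 0.
Proof. by move=> /subnK <- e; rewrite exprD -scalerA e scaler0. Qed.

Lemma ytorsion_submod : submod (ytorsion y (M := M)).
Proof.
split=> [j|u v tu tv j|a u _ tu j].
- by exists 0%N; rewrite scaler0.
- have [[N NE] [N' NE']] := (tu j, tv j); exists (maxn N N').
  rewrite scalerBr (expr_kill_le (leq_maxl _ _) NE).
  by rewrite (expr_kill_le (leq_maxr _ _) NE') subrr.
- have [N NE] := tu j; exists N.
  by rewrite scalerA mulrC -scalerA NE scaler0.
Qed.

Definition torsq : lmodType R := qmod (Submodule ytorsion_submod).
Definition to_torsq : {linear M -> torsq} := to_qmod (Submodule ytorsion_submod).

Lemma to_torsqW w : exists v, to_torsq v = w.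
Proof. by have [v ->] := to_qmodW w; exists v. Qed.

Lemma to_torsq_eq0 v : to_torsq v = 0 <-> ytorsion y v.
Proof. exact: to_qmod_eq0. Qed.

Lemma to_torsq_ker v : to_torsq v = 0 -> ytorsion y v.
Proof. by move/to_torsq_eq0. Qed.

Lemma torsq_torsion_free (w : torsq) : ytorsion y w -> w = 0.
Proof.
have [v <-] := to_torsqW w => tw; apply/to_torsq_eq0 => j.
have [N] := tw j; rewrite -linearZ => /to_torsq_eq0/(_ j)[N' NE].
by exists (N' + N)%N; rewrite exprD -scalerA.
Qed.

Lemma lc_zero_torsq i : lc_zero M y i.+1 <-> lc_zero torsq y i.+1.
Proof. exact: lc_zero_torsion_iff to_torsqW to_torsq_ker i. Qed.

End TorsionQuotient.

Section PowerTorsion.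
Variables (R : comNzRingType) (C : lmodType R) (B : C -> Prop).
Hypothesis hB : submod B.

(** Every term of the binomial expansion has at least [p] factors [a] or at least [q] factors
    [b]. *)
Lemma power_torsionD a b p q (c : C) :
  B (a ^+ p *: c) -> B (b ^+ q *: c) -> B ((a + b) ^+ (p + q) *: c).
Proof.
move=> Ba Bb; rewrite exprDn scaler_suml; apply: (osub_sum hB) => i _.
rewrite -scalerMnl -scaler_nat; apply: (submodZ hB).
have [qi|iq] := leqP q i.
  by rewrite -(subnK qi) exprD mulrA -scalerA; apply: (submodZ hB).
have pi : (p <= p + q - i)%N by lia.
by rewrite -(subnK pi) exprD mulrAC -scalerA; apply: (submodZ hB).
Qed.

Lemma power_torsion_lin (I : Type) (r : seq I) (y a : I -> R) (c : C) :
  (forall j, exists N, B (y j ^+ N *: c)) ->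
  exists N, B ((\sum_(j <- r) a j * y j) ^+ N *: c).
Proof.
move=> tors; elim: r => [|j r [N IH]].
  by exists 1%N; rewrite big_nil expr1 scale0r; apply: osub0 hB.
have [N' NE] := tors j; exists (N' + N)%N; rewrite big_cons.
apply: power_torsionD IH; rewrite exprMn -scalerA; exact: (submodZ hB).
Qed.

End PowerTorsion.

(** The chain is pushed forward to [B], and its stabilization is pulled back with
    [coboundary_torsion_ker]. *)
Lemma dcc_torsion_ker (R : comNzRingType) (n : nat) (y : 'I_n -> R)
    (A B : lmodType R) (g : {linear A -> B}) i :
  (forall w, exists v, g v = w) -> (forall v, g v = 0 -> ytorsion y v) ->
  dcc (@cocycle R B n y i.+1) (coboundary i.+1) ->
  dcc (@cocycle R A n y i.+1) (coboundary i.+1).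
Proof.
move=> surj ker dB E hE EE; have hg := linear_ysl y g.
have hZ := cocycle_submod B y i.+1; have hB := coboundary_submod B y i.+1.
pose F k c := exists e b, [/\ E k e, coboundary i.+1 b & c = cmap g e + b].
have [||k kP] := dB F.
- move=> k; have [hEk BE EZ] := hE k; split.
  + split.
    * exists 0, 0; rewrite (cmap0 hg) addr0.
      by split=> //; [exact: osub0 hEk|exact: osub0 hB].
    * move=> _ _ [e [b [Ee Bb ->]]] [e' [b' [Ee' Bb' ->]]].
      exists (e - e'), (b - b').
      split; [exact: (osubB hEk)|exact: (osubB hB)|].
      by rewrite (cmapB hg) opprD addrACA.
    * move=> a _ _ [e [b [Ee Bb ->]]]; exists (a *: e), (a *: b).
      split; [exact: submodZ|exact: submodZ|].
      by rewrite cmapZ scalerDr.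
  + move=> b Bb; exists 0, b; rewrite (cmap0 hg) add0r.
    by split=> //; exact: osub0 hEk.
  + move=> _ [e [b [Ee Bb ->]]]; apply: (osubD hZ).
      exact/(cmap_cocycle hg)/EZ.
    exact: coboundary_cocycle.
- by move=> k _ [e [b [Ee Bb ->]]]; exists e, b; split=> //; apply: EE.
exists k => j kj e Ee; have [hEj BE EjZ] := hE j; have [_ _ EZ] := hE k.
have [|e' [b [Ee' Bb eE]]] := kP j kj (cmap g e).
  by exists e, 0; rewrite addr0; split=> //; exact: osub0 hB.
rewrite -[e](subrK e'); apply: (osubD hEj) => //; apply: BE.
have ed := osubB (cocycle_submod A y i.+1) (EZ _ Ee) (EjZ _ Ee').
apply: (coboundary_torsion_ker surj ker); first by case: ed.
by rewrite (cmapB hg) eE addrC addKr.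
Qed.

(** * Local cohomology of modules on which the [x]-variables are nilpotent *)

Section TopCohomology.
Variables (K : fieldType) (m n : nat).
Hypothesis infK : infinite_set [set: K].
Local Notation S := {mpoly K[m + n]}.
Local Notation yv := (@yvar K m n).
Local Notation xv i := ('X_(lshift n i) : S).
Implicit Types (W : lmodType S).

(** Every product of [k] of the [x]-variables kills [w]; thus [xnil] says that a power of the ideal
    of the [x]-variables annihilates the module. *)
Fixpoint xkill W (k : nat) (w : W) : Prop :=
  if k is k'.+1 then forall i : 'I_m, xkill k' (xv i *: w) else w = 0.

Definition xnil W : Prop := exists k, forall w : W, xkill k w.

Lemma xkill_expr W k (w : W) i : xkill k w -> xv i ^+ k *: w = 0.
Proof.
elim: k w => [|k IH] w; first by rewrite scale1r.
by move=> /(_ i)/IH; rewrite scalerA -exprSr.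
Qed.

Lemma xnil_surj W W' (g : {linear W -> W'}) :
  (forall w, exists v, g v = w) -> xnil W -> xnil W'.
Proof.
move=> surj [k kP]; exists k => w; have [v <-] := surj w.
elim: k v {kP w surj}(kP v) => [|k IH] v /=; first by move->; rewrite linear0.
by move=> kv i; rewrite -linearZ; apply: IH.
Qed.

Lemma torsion_free_generic_regular W : fin_gen W ->
  (forall w : W, ytorsion yv w -> w = 0) ->
  generic (fun t => regular_on W (ylin m n t)).
Proof.
move=> fW tfW; apply: generic_regular; first exact: fin_gen_noeth.
by move=> v v0; apply: tfW => j; exists 1%N; rewrite expr1.
Qed.

Lemma fin_gen_torsq W : fin_gen W -> fin_gen (torsq yv W).
Proof. exact: (fin_gen_surj (g := to_torsq yv W) (@to_torsqW _ _ _ _)). Qed.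

Lemma fin_gen_quotz W z : fin_gen W -> fin_gen (quotz W z).
Proof. exact: (fin_gen_surj (g := to_quotz z) (@to_quotzW _ _ z)). Qed.

Lemma torsq_generic_regular W : fin_gen W ->
  generic (fun t => regular_on (torsq yv W) (ylin m n t)).
Proof.
move=> fW; apply: torsion_free_generic_regular; first exact: fin_gen_torsq.
exact: torsq_torsion_free.
Qed.

Lemma cocycle_ylin_torsion W i (c : cech W yv) t : cocycle i c ->
  exists N, coboundary i (ylin m n t ^+ N *: c).
Proof.
move=> hc; apply: (power_torsion_lin (coboundary_submod _ _ _)) => j.
exact: cocycle_torsion.
Qed.

(** Every variable acts on [H^0] with power torsion: the [x_i] by nilpotence, the [y_j] because Cech
    classes are torsion. Melkersson's criterion reduces to the part killed by all variables, which
    [psi] identifies with part of the socle of [W], a finite-dimensional space. *)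
Lemma lc0_dcc W : fin_gen W -> xnil W ->
  dcc (@cocycle S W n yv 0) (coboundary 0).
Proof.
move=> fW [k kP].
have hB := coboundary_submod W yv 0.
apply: (@dcc_power_torsion_seq _ _ _ _ [seq 'X_i | i : 'I_(m + n)]) => //.
- exact: cocycle_submod.
- exact: coboundary_cocycle.
- move=> _ c /mapP[i _ ->] hc; case: (split_ordP i) => [i' ->|j ->].
    exists k; have [v [l ->]] := cech_frc c; apply/coboundary0E.
    rewrite -frcZ; apply: cechP => s; rewrite /frc xkill_expr //.
    exact: frac0.
  exact: cocycle_torsion.
pose psi (v : W) : cech W yv := frc yv (fun s => if s == finset.set0 then v else 0) 0.
have psiB u v : psi (u - v) = psi u - psi v.
  apply: cechP => s; rewrite cechD cechN /psi /frc; case: eqP => _.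
    by rewrite fracD fracN.
  by rewrite frac0 subrr.
have psiZ a v : psi (a *: v) = a *: psi v.
  by rewrite /psi -frcZ; congr frc; apply/funext => s; case: eqP; rewrite ?scaler0.
have psi0 v : psi v = 0 -> v = 0.
  move/frc_eq0 => [t /(_ finset.set0)].
  by rewrite eqxx /yprod big_set0 expr1n scale1r.
have psiE c : cocycle 0 c -> exists v, c = psi v.
  move=> /cocycle_frc[v [l [-> _ vi]]]; exists (v finset.set0).
  apply: cechP => s; rewrite /psi /frc; case: eqP => [->|s0].
    by apply/fracP; exists 0%N; rewrite /yprod big_set0 !expr1n.
  by rewrite vi ?frac0 // => /eqP; rewrite cards_eq0 => /eqP.
pose soc (v : W) := forall i, 'X_i *: v = 0.
have hsoc : submod soc.
  split=> [i|u v hu hv i|a u _ hu i]; first by rewrite scaler0.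
    by rewrite scalerBr hu hv subrr.
  by rewrite scalerA mulrC -scalerA hu scaler0.
move=> E hE EE.
have [||//|l lP] := @socle_dcc _ _ _ soc (fin_gen_noeth fW) hsoc _
    (fun l v => soc v /\ E l (psi v)).
- by move=> v i; apply.
- move=> l; have [hEl BE _] := hE l; split.
  + split.
    * split; first exact: osub0 hsoc.
      by apply: BE; apply/coboundary0E; rewrite -(scale0r 0) psiZ scale0r.
    * move=> u v [su Eu] [sv Ev]; split; first exact: (osubB hsoc).
      by rewrite psiB; apply: (osubB hEl).
    * move=> a u _ [su Eu]; split; first exact: (submodZ hsoc).
      by rewrite psiZ; apply: (submodZ hEl).
  + move=> _ ->; split; first exact: osub0 hsoc.
    by apply: BE; apply/coboundary0E; rewrite -(scale0r 0) psiZ scale0r.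
  + by move=> v [].
- by move=> l' v [sv Ev]; split=> //; apply: EE.
exists l => j lj e Ee; have [_ _ EZ] := hE l; have [/psiE[v ev] ze] := EZ e Ee.
have [] := lP j lj v; last by rewrite ev.
split; last by rewrite -ev.
move=> i; apply: psi0; rewrite psiZ -ev; apply/coboundary0E/ze.
by apply: map_f; rewrite mem_enum.
Qed.

(** Modulo torsion a generic form [z] is regular. The kernel of [z] on [H^(i+1)] is a quotient of
    [H^i] of the module modulo [z], hence artinian by induction, and Melkersson's criterion for [z]
    applies. *)
Lemma lc_dcc W i : fin_gen W -> xnil W ->
  dcc (@cocycle S W n yv i) (coboundary i).
Proof.
elim: i W => [|i IH] W fW nW; first exact: lc0_dcc.
apply: (@dcc_torsion_ker _ _ yv W _ (to_torsq yv W) i (@to_torsqW _ _ _ _)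
  (@to_torsq_ker _ _ _ _)).
have [t treg] := generic_ex infK (torsq_generic_regular fW).
apply: (dcc_power_torsion (cocycle_submod _ _ _) (coboundary_submod _ _ _)
  (@coboundary_cocycle _ _ _ _ _) (z := ylin m n t)).
  by move=> c; apply: cocycle_ylin_torsion.
apply: (dcc_connecting treg (@to_quotzW _ _ _) (@to_quotz_eq0 _ _ _)).
apply: IH; first exact/fin_gen_quotz/fin_gen_torsq.
apply: (xnil_surj (g := to_quotz _) (@to_quotzW _ _ _)).
exact: (xnil_surj (g := to_torsq yv W) (@to_torsqW _ _ _ _) nW).
Qed.

Lemma regular_quotient_vanishing W z i : regular_on W z ->
  lc_zero W yv i -> lc_zero W yv i.+1 -> lc_zero (quotz W z) yv i.
Proof.
move=> zreg Wi Wi1.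
apply: (lc_zero_quotient zreg (@to_quotzW _ _ _) (@to_quotz_eq0 _ _ _) Wi1).
move=> c /Wi ci; exists 0, c; rewrite scaler0 add0r; split=> //.
exact: osub0 (cocycle_submod _ _ _).
Qed.

Lemma ylin_scale (C : lmodType S) t (u : C) :
  ylin m n t *: u = \sum_(j < n) yv j *: ((t ^+ j)%:MP *: u).
Proof.
rewrite /ylin scaler_suml; apply: eq_bigr => j _.
by rewrite scalerA mulrC.
Qed.

(* Induction on the number of further linear forms needed to kill [W]. *)
Lemma top_cocycle_divisible_aux q k W ts : fin_gen W -> uniq ts ->
  (size ts + k = n)%N -> (forall t (w : W), t \in ts -> ylin m n t *: w = 0) ->
  (forall i, (q.+1 < i)%N -> lc_zero W yv i) ->
  forall c, cocycle q.+1 c -> exists (a : 'I_n -> cech W yv) b,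
   [/\ forall j, cocycle q.+1 (a j), coboundary q.+1 b
     & c = \sum_(j < n) yv j *: a j + b].
Proof.
elim: k W ts => [|k IH] W ts fW uts sts tsW W0 c hc.
  (* For [k = 0] there are [n] distinct forms killing [W]; they span the [y_j], so [W] is torsion
     and [c] is a coboundary. *)
  have ytors (w : W) : ytorsion yv w.
    move=> j; exists 1%N; rewrite expr1; rewrite addn0 in sts.
    apply: (@ylin_span _ _ _ _ (fun w : W => w = 0) w ts) => //; last first.
      by move=> t /tsW.
    split=> //; first by move=> u v -> ->; rewrite subr0.
    by move=> a u _ ->; rewrite scaler0.
  exists (fun=> 0), c; split.
  - by move=> _; apply: osub0 (cocycle_submod _ _ _).
  - exact: (lc_zero_torsion ytors).
  - by rewrite big1 ?add0r // => j _; rewrite scaler0.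
set W' := torsq yv W; pose g := to_torsq yv W; have hg := linear_ysl yv g.
have surj := to_torsqW (y := yv) (M := W).
have ker := to_torsq_ker (y := yv) (M := W).
have [|t [treg tts]] := @generic_ex _ (fun t => regular_on W' (ylin m n t)
    /\ t \notin ts) infK.
  by apply: genericI; [exact: torsq_generic_regular|exists ts].
set z := ylin m n t in treg; set N := quotz W' z; pose p := to_quotz (M := W') z.
have hp : ysemilinear yv p := linear_ysl yv (to_quotz z).
have psurj := @to_quotzW _ W' z; have pker := @to_quotz_eq0 _ W' z.
have W'0 i : (q.+1 < i)%N -> lc_zero W' yv i.
  by case: i => // i qi; apply: (@lc_zero_torsq _ _ yv W i).1; apply: W0.
have [||||||aN [bN [haN hbN eN]]] := IH N (t :: ts) _ _ _ _ _ (cmap p (cmap g c)).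
- exact/fin_gen_quotz/fin_gen_torsq.
- by rewrite /= tts.
- by rewrite /= addSnnS.
- move=> t' w; have [w' <-] := psurj w; rewrite in_cons -linearZ.
  case/predU1P => [->|t'ts]; first by apply/pker; exists w'.
  by have [v <-] := surj w'; rewrite -linearZ tsW // !linear0.
- move=> i qi; apply: regular_quotient_vanishing treg _ _; apply: W'0 => //.
  exact: ltnW.
- exact/(cmap_cocycle hp)/(cmap_cocycle hg).
have [a1 a1P] := choice (fun j => let: ex_intro2 x hx ex :=
  cocycle_lift treg psurj pker (W'0 _ (ltnSn _)) (haN j) in
  ex_intro (fun x => cocycle q.+1 x /\ cmap p x = aN j) x (conj hx ex)).
have [b1 hb1 eb1] : exists2 b1, coboundary q.+1 b1 & cmap p b1 = bN.
  have /coboundaryE[b0 b0q ->] := hbN.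
  have [b0' b0'q <-] := cmap_lift hp psurj b0q.
  exists (cech_d b0'); last by rewrite (cmap_d hp).
  by apply/coboundaryE; exists b0'.
have hZ' := cocycle_submod W' yv q.+1.
have [|u eu] := @cmap_ker _ _ yv _ _ _ _ pker
    (cmap g c - (\sum_(j < n) yv j *: a1 j + b1)).
  rewrite (cmapB hp) (cmapD hp) eN eb1 (big_morph _ (cmapD hp) (cmap0 hp)).
  have -> : \sum_(j < n) cmap p (yv j *: a1 j) = \sum_(j < n) yv j *: aN j.
    by apply: eq_bigr => j _; rewrite cmapZ (a1P j).2.
  exact: subrr.
have hu : cocycle q.+1 u.
  have : cocycle q.+1 (z *: u).
    rewrite -eu; apply: (osubB hZ'); first exact: cmap_cocycle.
    apply: (osubD hZ'); last exact: coboundary_cocycle.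
    by apply: (osub_sum hZ') => j _; apply: (submodZ hZ'); case: (a1P j).
  case/cocycleE => zi dz; apply/cocycleE; split.
    exact: cech_deg_regular treg _ _ zi.
  by apply: (cech_regular treg); rewrite -cech_dZ.
(* By [ylin_scale] the remainder [z *: u] is a combination of the [y_j], so it can be absorbed into
   the coefficients before these are lifted to [W]. *)
have ha2 j : cocycle q.+1 (a1 j + (t ^+ j)%:MP *: u).
  by apply: (osubD hZ'); [case: (a1P j)|apply: (submodZ hZ')].
have [a aP] := choice (fun j => let: ex_intro2 x hx ex :=
  cocycle_torsion_lift surj ker (ha2 j) in
  ex_intro (fun x => cocycle q.+1 x /\ cmap g x = _) x (conj hx ex)).
exists a, (c - \sum_(j < n) yv j *: a j); split.
- by move=> j; case: (aP j).
- apply: (coboundary_torsion_ker surj ker).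
    apply: (osubB (cech_deg_submod _ _ _)); first by case: hc.
    apply: (osub_sum (cech_deg_submod _ _ _)) => j _.
    by apply: (submodZ (cech_deg_submod _ _ _)); case: (aP j) => -[].
  rewrite (cmapB hg) (big_morph _ (cmapD hg) (cmap0 hg)).
  have -> : \sum_(j < n) cmap g (yv j *: a j) =
      \sum_(j < n) yv j *: a1 j + \sum_(j < n) yv j *: ((t ^+ j)%:MP *: u).
    rewrite -big_split; apply: eq_bigr => j _.
    by rewrite cmapZ (aP j).2 scalerDr.
  rewrite -ylin_scale -/z -eu /=.
  suff -> : cmap g c - (\sum_(j < n) yv j *: a1 j +
      (cmap g c - (\sum_(j < n) yv j *: a1 j + b1))) = b1 by [].
  by rewrite opprD opprB !addrA subrK addrAC subrr add0r.
- by rewrite addrC subrK.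
Qed.

End TopCohomology.

(** * Nakayama's lemma *)

Section Nakayama.
Variables (R : comNzRingType) (L : lmodType R) (n : nat) (y : 'I_n -> R).

Definition inI (p : R) : Prop := exists b : 'I_n -> R, p = \sum_(j < n) b j * y j.

Lemma inI_D p q : inI p -> inI q -> inI (p + q).
Proof.
move=> [b ->] [c ->]; exists (fun j => b j + c j).
by rewrite -big_split; apply: eq_bigr => j _; rewrite mulrDl.
Qed.

Lemma inI_M r p : inI p -> inI (r * p).
Proof.
move=> [b ->]; exists (fun j => r * b j).
by rewrite mulr_sumr; apply: eq_bigr => j _; rewrite mulrA.
Qed.

Lemma inI_1B_M p q : inI (1 - p) -> inI (1 - q) -> inI (1 - p * q).
Proof.
move=> hp hq; have -> : 1 - p * q = (1 - p) + p * (1 - q) by ring.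
by apply: inI_D => //; apply: inI_M.
Qed.

Lemma inI_1B_X p k : inI (1 - p) -> inI (1 - p ^+ k).
Proof.
move=> hp; elim: k => [|k IH]; last by rewrite exprS; apply: inI_1B_M.
by rewrite expr0 subrr; exists (fun=> 0); rewrite big1 // => j _; rewrite mul0r.
Qed.

Fixpoint sspan (g : seq L) (v : L) : Prop :=
  if g is x :: g' then exists c : R, sspan g' (v - c *: x) else v = 0.

Lemma sspan_submod g : submod (sspan g).
Proof.
elim: g => [|x g [h0 hB hZ]]; split => //=.
- by move=> u v -> ->; rewrite subr0.
- by move=> a u _ ->; rewrite scaler0.
- by exists 0; rewrite scale0r subr0.
- move=> u v [c hc] [d hd]; exists (c - d).
  have := hB _ _ hc hd; rewrite scalerBl !opprD !opprK.
  by rewrite addrACA.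
- move=> a u _ [c hc]; exists (a * c).
  by have := hZ a _ I hc; rewrite scalerBr scalerA.
Qed.

Lemma sspan_mem g x : x \in g -> sspan g x.
Proof.
elim: g => //= z g IH; rewrite in_cons => /predU1P[->|/IH].
  by exists 1; rewrite scale1r subrr; apply: osub0 (sspan_submod g).
by exists 0; rewrite scale0r subr0.
Qed.

(** The generators are eliminated one by one: the invariant is that [e] is 1 modulo the ideal and
    maps [L] into the span of the remaining generators [gs]. *)
Lemma nakayama : fin_gen L ->
  (forall v : L, exists a : 'I_n -> L, v = \sum_(j < n) y j *: a j) ->
  exists2 e : R, inI (1 - e) & forall v : L, e *: v = 0.
Proof.
move=> [r [g gP]] div.
suff H gs e : inI (1 - e) -> (forall v, sspan gs (e *: v)) ->
    exists2 e : R, inI (1 - e) & forall v : L, e *: v = 0.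
  apply: (H [seq g i | i <- enum 'I_r] 1).
    by exists (fun=> 0); rewrite subrr big1 // => j _; rewrite mul0r.
  move=> v; rewrite scale1r; have [a ->] := gP v.
  apply: (osub_sum (sspan_submod _)) => i _; apply: (submodZ (sspan_submod _)).
  by apply/sspan_mem/map_f; rewrite mem_enum.
elim: gs e => [|x gs IH] e eI egs; first by exists e.
have hs := sspan_submod gs; have [a xa] := div x.
have [c cP] := choice (fun j => egs (a j)).
pose b := \sum_(j < n) c j * y j.
(* Multiply [x = sum_j y_j a_j] by [e] and replace each [e *: a j] by [c j *: x] modulo the span of
   [gs]. *)
have xgs : sspan gs ((e - b) *: x).
  have -> : (e - b) *: x = \sum_(j < n) y j *: (e *: a j - c j *: x).
    rewrite scalerBl [in e *: x]xa scaler_sumr /b scaler_suml -sumrB.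
    by apply: eq_bigr => j _; rewrite scalerBr !scalerA ![_ * y j]mulrC.
  by apply: (osub_sum hs) => j _; apply: (submodZ hs); apply: cP.
apply: (IH ((e - b) * e)).
  apply: inI_1B_M => //; have -> : 1 - (e - b) = (1 - e) + b by ring.
  by apply: inI_D => //; exists c.
move=> v; have [d dP] := egs v; rewrite -scalerA -[e *: v](subrK (d *: x)).
rewrite scalerDr; apply: (osubD hs); first exact: (submodZ hs).
by rewrite scalerA mulrC -scalerA; apply: (submodZ hs).
Qed.

End Nakayama.

(** * Transfer of vanishing from [W] to the module it generates *)

Section Transfer.
Variables (K : fieldType) (m n : nat).
Hypothesis infK : infinite_set [set: K].
Local Notation S := {mpoly K[m + n]}.
Local Notation yv := (@yvar K m n).
Local Notation xv i := ('X_(lshift n i) : S).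
Implicit Types (M W : lmodType S).

Let in_nil_kill W t (w : W) : t \in [::] -> ylin m n t *: w = 0.
Proof. by []. Qed.

(** Computed for [W] modulo torsion: degree [q.+1] uses that the artinian top cohomology is
    divisible by a generic form, higher degrees use the long exact sequence. [quotz_torsion_map]
    brings the result back to [W]. *)
Lemma vanishing_generic_quotient q W : fin_gen W -> xnil W ->
  (forall i, (q.+1 < i)%N -> lc_zero W yv i) ->
  generic (fun t => forall i, (q < i)%N -> lc_zero (quotz W (ylin m n t)) yv i).
Proof.
move=> fW nW W0; set W' := torsq yv W.
have surj := to_torsqW (y := yv) (M := W).
have ker := to_torsq_ker (y := yv) (M := W).
have fW' : fin_gen W' := fin_gen_torsq fW.
have nW' : xnil W' := xnil_surj (g := to_torsq yv W) surj nW.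
have W'0 i : (q.+1 < i)%N -> lc_zero W' yv i.
  by case: i => // i qi; apply: (@lc_zero_torsq _ _ yv W i).1; apply: W0.
have hZ := cocycle_submod W' yv q.+1; have hB := coboundary_submod W' yv q.+1.
have gdiv := generic_divisible hZ hB (@coboundary_cocycle _ _ _ _ _)
  (lc_dcc infK (i := q.+1) fW' nW')
  (@top_cocycle_divisible_aux _ _ _ infK q n W' [::] fW' isT (erefl _)
     (@in_nil_kill _) W'0).
have [s sP] := genericI (torsq_generic_regular fW) gdiv.
exists s => t /sP[treg tdiv].
have N0 i : (q < i)%N -> lc_zero (quotz W' (ylin m n t)) yv i.
  rewrite leq_eqVlt => /predU1P[<-|qi].
    apply: (lc_zero_quotient treg (@to_quotzW _ _ _) (@to_quotz_eq0 _ _ _)) => //.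
    exact: W'0.
  by apply: regular_quotient_vanishing => //; apply: W'0 => //; apply: ltnW.
have [h [hsurj hker]] := quotz_torsion_map (g := to_torsq yv W) (ylin m n t) surj ker.
by case=> // i qi; apply: (lc_zero_torsion_iff hsurj hker i).2; apply: N0.
Qed.

(** A generic form is regular on [W] and its quotient is again acyclic. After [n] distinct forms the
    module is both torsion and torsion-free, hence zero. This provides [W = QW] for Nakayama's
    lemma. *)
Lemma acyclic_divisible_aux k W ts : fin_gen W -> uniq ts ->
  (size ts + k = n)%N -> (forall t (w : W), t \in ts -> ylin m n t *: w = 0) ->
  (forall i, lc_zero W yv i) ->
  forall w : W, exists a : 'I_n -> W, w = \sum_(j < n) yv j *: a j.
Proof.
elim: k W ts => [|k IH] W ts fW uts sts tsW W0 w.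
all: have tfW := (lc_zero0P yv W).1 (W0 0%N).
  suff -> : w = 0.
    by exists (fun=> 0); rewrite big1 // => j _; rewrite scaler0.
  apply: tfW => j; exists 1%N; rewrite expr1; rewrite addn0 in sts.
  apply: (@ylin_span _ _ _ _ (fun w : W => w = 0) w ts) => //; last first.
    by move=> t /tsW.
  split=> //; first by move=> u v -> ->; rewrite subr0.
  by move=> a u _ ->; rewrite scaler0.
have [|t [treg tts]] := @generic_ex _ (fun t => regular_on W (ylin m n t)
    /\ t \notin ts) infK.
  by apply: genericI; [exact: torsion_free_generic_regular|exists ts].
have [|||||a' aE] := IH (quotz W (ylin m n t)) (t :: ts) _ _ _ _ _ (to_quotz _ w).
- exact: fin_gen_quotz.
- by rewrite /= tts.
- by rewrite /= addSnnS.
- move=> t' x; have [v <-] := to_quotzW x; rewrite in_cons -linearZ.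
  case/predU1P => [->|t'ts]; first by apply/to_quotz_eq0; exists v.
  by rewrite tsW // linear0.
- by move=> i; apply: regular_quotient_vanishing.
have [a aP] := choice (fun j => to_quotzW (a' j)).
have [|u uE] := (to_quotz_eq0 (ylin m n t) (w - \sum_(j < n) yv j *: a j)).1.
  rewrite linearB linear_sum /= aE.
  have -> : \sum_(j < n) to_quotz (ylin m n t) (yv j *: a j) =
      \sum_(j < n) yv j *: a' j.
    by apply: eq_bigr => j _; rewrite linearZ /= aP.
  exact: subrr.
exists (fun j => a j + (t ^+ j)%:MP *: u).
under eq_bigr do rewrite scalerDr.
by rewrite big_split /= -ylin_scale -uE addrC subrK.
Qed.

Definition killx (i : 'I_(m + n)) : S :=
  if split i is inr j then yv j else 0.

(* The substitution [x := 0]; its image is [K[y]]. *)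
Definition rho (p : S) : S := comp_mpoly [tuple killx i | i < m + n] p.

Lemma rhoX i : rho 'X_i = killx i.
Proof. by rewrite /rho comp_mpolyXU -tnth_nth tnth_mktuple. Qed.

Lemma rhoy j : rho (yv j) = yv j.
Proof.
rewrite rhoX /killx; case: split_ordP => [k /esym/eqP|k /rshift_inj -> //].
by rewrite eq_lrshift.
Qed.

Lemma rhoD p q : rho (p + q) = rho p + rho q. Proof. exact: rmorphD. Qed.
Lemma rhoM p q : rho (p * q) = rho p * rho q. Proof. exact: rmorphM. Qed.
Lemma rhoC c : rho c%:MP = c%:MP. Proof. exact: comp_mpolyC. Qed.

(** Hence on an [xnil] module the actions of [p] and of [rho p] in [K[y]] differ by a nilpotent. *)
Lemma sub_rho p : exists b : 'I_m -> S, rho p - p = \sum_(i < m) b i * xv i.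
Proof.
pose J := inI (fun i => xv i); suff : J (rho p - p) by [].
have J0 : J 0 by exists (fun=> 0); rewrite big1 // => j _; rewrite mul0r.
elim/mpoly_ring_ind: p => [c|i|p q hp hq|p q hp hq].
- by rewrite rhoC subrr.
- rewrite rhoX /killx; case: split_ordP => [k ->|k ->]; last by rewrite subrr.
  exists (fun i => - (i == k)%:R); rewrite sub0r (bigD1 k) //= eqxx mulN1r.
  by rewrite big1 ?addr0 // => i0 /negPf ->; rewrite oppr0 mul0r.
- by rewrite rhoD opprD addrACA; apply: inI_D.
- have -> : rho (p * q) - p * q = rho q * (rho p - p) + p * (rho q - q).
    rewrite rhoM; ring.
  by apply: inI_D; apply: inI_M.
Qed.

Lemma xkill_sub_rho W k (w : W) p : xkill k w -> (rho p - p) ^+ k *: w = 0.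
Proof.
have [b ->] := sub_rho p; elim: k w => [|k IH] w; first by rewrite scale1r.
move=> kw; rewrite exprSr -scalerA scaler_suml scaler_sumr.
apply: big1 => i _; set X := _ ^+ k.
have -> : X *: ((b i * xv i) *: w) = b i *: (X *: (xv i *: w)).
  by rewrite !scalerA mulrCA mulrA.
by rewrite IH ?scaler0 //; apply: kw.
Qed.

(* [sigma] is [K[y]]-linear and its image generates the [S]-module [M]. *)
Definition ygenerates M W (sigma : W -> M) : Prop :=
  [/\ ysemilinear yv sigma,
      forall (c : K) w, sigma (c%:MP *: w) = c%:MP *: sigma w
    & forall L : M -> Prop, submod L -> (forall w, L (sigma w)) -> forall v, L v].

Lemma ygenerates_rho M W (sigma : W -> M) : ygenerates sigma ->
  forall p w, sigma (rho p *: w) = rho p *: sigma w.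
Proof.
move=> [[sD sy] sC _] p; elim/mpoly_ring_ind: p => [c|i|p q hp hq|p q hp hq] w.
- by rewrite rhoC sC.
- rewrite rhoX /killx; case: splitP => j _; last exact: sy.
  by rewrite !scale0r -(scale0r 0) -{1}mpolyC0 sC mpolyC0 !scale0r.
- by rewrite rhoD !scalerDl sD hp hq.
- by rewrite rhoM -!scalerA hp hq.
Qed.

Lemma ygenerates_quotz M W (sigma : W -> M) t : ygenerates sigma ->
  exists sigma' : quotz W (ylin m n t) -> quotz M (ylin m n t), ygenerates sigma'.
Proof.
move=> gs; have srho := ygenerates_rho gs; have [hs sC sgen] := gs.
have [sD sy] := hs; set z := ylin m n t.
have sz w : sigma (z *: w) = z *: sigma w.
  rewrite /z !ylin_scale (ysl_sum hs); apply: eq_bigr => j _.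
  by rewrite sy sC.
exists (fun x => to_quotz z (sigma (repr x))).
have E w : to_quotz z (sigma (repr (to_quotz z w))) = to_quotz z (sigma w).
  have /to_quotzP[u uE] := to_quotz_repr (to_quotz z w).
  by apply/to_quotzP; exists (sigma u); rewrite -sz -uE sD (yslN hs).
split; first split.
- move=> x x'; have [w <-] := to_quotzW x; have [w' <-] := to_quotzW x'.
  by rewrite -linearD !E sD linearD.
- by move=> j x; have [w <-] := to_quotzW x; rewrite -linearZ !E sy linearZ.
- by move=> c x; have [w <-] := to_quotzW x; rewrite -linearZ !E sC linearZ.
move=> L hL Ls x; have [v <-] := to_quotzW x.
apply: (sgen (fun v => L (to_quotz z v))); last by move=> w; rewrite -E.
split; first by rewrite linear0; apply: osub0 hL.
  by move=> u w Lu Lw; rewrite linearB; apply: (osubB hL).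
by move=> a u _ Lu; rewrite linearZ; apply: (submodZ hL).
Qed.

(** [W] modulo torsion is acyclic, so Nakayama's lemma applies to it. The outcome is a power of [e0]
    that makes [M] torsion, hence acts as zero on positive cochains of [M], while its difference
    from 1 acts on cohomology with power torsion. *)
Lemma vanishing_transfer0 M W (sigma : W -> M) : fin_gen W -> xnil W ->
  ygenerates sigma -> (forall i, (0 < i)%N -> lc_zero W yv i) ->
  forall i, (0 < i)%N -> lc_zero M yv i.
Proof.
move=> fW nW gs W0; set W' := torsq yv W.
have surj := to_torsqW (y := yv) (M := W).
have fW' : fin_gen W' := fin_gen_torsq fW.
have [k kP] : xnil W' := xnil_surj (g := to_torsq yv W) surj nW.
have W'0 i : lc_zero W' yv i.
  case: i => [|i]; last by apply: (@lc_zero_torsq _ _ yv W i).1; apply: W0.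
  by apply/lc_zero0P; apply: torsq_torsion_free.
have W'div := @acyclic_divisible_aux n W' [::] fW' isT (erefl _)
  (@in_nil_kill _) W'0.
have [e [b eb] eW'] := nakayama fW' W'div.
(* Passing to [K[y]] lets the element commute with [sigma], and it stays in [1 + Q]. On [W'] the
   element [e] is zero, so [e0] acts there as the nilpotent [e0 - e]. *)
pose e0 := rho e.
have e0I : inI yv (1 - e0 ^+ k).
  apply: inI_1B_X; exists (fun j => rho (b j)).
  have <- : rho (1 - e) = 1 - e0 by rewrite /rho rmorphB rmorph1.
  rewrite eb /rho rmorph_sum; apply: eq_bigr => j _.
  exact: etrans (rhoM _ _) (congr1 _ (rhoy j)).
have e0W' (w : W') : e0 ^+ k *: w = 0.
  suff H l v : (e0 - e) ^+ l *: v = e0 ^+ l *: v :> W'.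
    by rewrite -H; apply: xkill_sub_rho.
  elim: l v => [|l IH] v; first by [].
  by rewrite !exprSr -!scalerA scalerBl eW' subr0 IH.
have e0M v : ytorsion yv (e0 ^+ k *: v : M).
  have srho := ygenerates_rho gs; have [hs _ sgen] := gs.
  apply: (sgen (fun v => ytorsion yv (e0 ^+ k *: v))).
    have hT := ytorsion_submod yv M; split.
    - by rewrite scaler0; apply: osub0 hT.
    - by move=> u w Tu Tw; rewrite scalerBr; apply: (osubB hT).
    - move=> a u _ Tu; rewrite scalerA mulrC -scalerA; exact: (submodZ hT).
  move=> w j; have /to_torsq_eq0/(_ j)[N NE] : to_torsq yv W (e0 ^+ k *: w) = 0.
    by rewrite linearZ; apply: e0W'.
  exists N; have -> : e0 ^+ k *: sigma w = sigma (e0 ^+ k *: w).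
    by rewrite /e0 /rho -rmorphXn srho.
  by rewrite -(yslX hs) NE (ysl0 hs).
case=> // i _ c hc.
have hB := coboundary_submod M yv i.+1.
have e0c : e0 ^+ k *: c = 0.
  have [v [l cE]] := cech_frc c; apply: cechP => s.
  have [si|si] := eqVneq #|s| i.+1; last first.
    rewrite cechZ (_ : c s = 0) ?scaler0 //.
    by case: hc => ci _; apply: ci; apply/eqP.
  have [j js] : exists j, j \in s by apply/set0Pn; rewrite -card_gt0 si.
  rewrite cechZ cE -fracZ; apply/frac_eq0; have [N NE] := e0M (v s) j.
  by exists N; rewrite (yprodD1 _ js) exprMn -scalerA NE scaler0.
have [b' b'E] := e0I.
have [N NE] : exists N, coboundary i.+1 ((1 - e0 ^+ k) ^+ N *: c).
  by rewrite b'E; apply: power_torsion_lin => // j; apply: cocycle_torsion hc.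
(* Since [e0 ^+ k] kills [c], its complement fixes [c]. *)
suff -> : c = (1 - e0 ^+ k) ^+ N *: c by [].
elim: N {NE} => [|N {1}->]; first by rewrite scale1r.
by rewrite exprSr -scalerA scalerBl scale1r e0c subr0.
Qed.

(** Induction on [q], with one generic [z] that lowers the bound for [W] and is regular on [M]
    modulo torsion. Vanishing for the quotient by [z] makes [z] injective one degree higher, where
    every class is killed by a power of [z]. *)
Lemma vanishing_transfer q M W (sigma : W -> M) : fin_gen M -> fin_gen W ->
  xnil W -> ygenerates sigma -> (forall i, (q < i)%N -> lc_zero W yv i) ->
  forall i, (q < i)%N -> lc_zero M yv i.
Proof.
elim: q M W sigma => [|q IH] M W sigma fM fW nW gs W0.
  exact: vanishing_transfer0 gs W0.
have [|t [tW treg]] := @generic_ex _ (fun t =>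
    (forall i, (q < i)%N -> lc_zero (quotz W (ylin m n t)) yv i) /\
    regular_on (torsq yv M) (ylin m n t)) infK.
  apply: genericI; first exact: vanishing_generic_quotient.
  exact: torsq_generic_regular.
set z := ylin m n t in tW treg.
have [sigma' gs'] := ygenerates_quotz t gs.
have Mz := IH (quotz M z) (quotz W z) sigma' (fin_gen_quotz _ fM)
  (fin_gen_quotz _ fW) (xnil_surj (g := to_quotz z) (@to_quotzW _ _ z) nW) gs' tW.
have [h [hsurj hker]] := quotz_torsion_map (g := to_torsq yv M) z
  (to_torsqW (y := yv) (M := M)) (to_torsq_ker (y := yv) (M := M)).
case=> // i qi; apply: (@lc_zero_torsq _ _ yv M i).2 => c hc.
have N0 : lc_zero (quotz (torsq yv M) z) yv i.
  case: i qi {c hc} => // i qi.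
  by apply: (lc_zero_torsion_iff hsurj hker i).1; apply: Mz.
have [N] := cocycle_ylin_torsion t hc.
elim: N => [|N IHN]; first by rewrite scale1r.
rewrite exprS -scalerA => /(coboundary_regular treg (@to_quotzW _ _ _)
  (@to_quotz_eq0 _ _ _) N0) h'; apply: IHN; apply: h'.
exact: (submodZ (cocycle_submod _ _ _)).
Qed.

End Transfer.

(** * Bidegrees of constants, variables and linear forms *)

Section Bihomogeneous.
Variables (K : fieldType) (m n : nat).
Local Notation S := {mpoly K[m + n]}.
Local Notation yv := (@yvar K m n).

Lemma bihomogX u : bihomog (xdeg u) (ydeg u) ('X_[u] : S).
Proof. by move=> v; rewrite msuppX inE => /eqP ->. Qed.

Lemma bihomogC (c : K) : bihomog 0 0 (c%:MP : S).
Proof.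
move=> v; rewrite msuppC; case: ifP => // _; rewrite inE => /eqP ->.
by rewrite /xdeg /ydeg !big1 // => i _; rewrite mnm0E.
Qed.

Lemma bihomog_x (i : 'I_m) : bihomog 1 0 ('X_(lshift n i) : S).
Proof.
have := @bihomogX U_(lshift n i)%MM; congr bihomog.
  rewrite /xdeg (bigD1 i) //= mnm1E eqxx big1 // => i' ii'.
  by rewrite mnm1E eq_lshift eq_sym (negPf ii').
by rewrite /ydeg big1 // => j _; rewrite mnm1E eq_lrshift.
Qed.

Lemma bihomog_y j : bihomog 0 1 (yv j).
Proof.
have := @bihomogX U_(rshift m j)%MM; congr bihomog.
  by rewrite /xdeg big1 // => i _; rewrite mnm1E eq_rlshift.
rewrite /ydeg (bigD1 j) //= mnm1E eqxx big1 // => i' ii'.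
by rewrite mnm1E eq_rshift eq_sym (negPf ii').
Qed.

Lemma bihomog_ylin (t : K) : bihomog 0 1 (ylin m n t).
Proof.
rewrite /ylin; apply: (big_ind (@bihomog K m n 0 1)) => [u|p q hp hq u|j _ u].
- by rewrite msupp0.
- by move/msuppD_le; rewrite mem_cat => /orP[/hp|/hq].
- by rewrite mul_mpolyC => /msuppZ_le/bihomog_y.
Qed.

End Bihomogeneous.

(** * Truncation by [x]-degree, and the grading of the quotient *)

Section Truncation.
Variables (K : fieldType) (m n : nat).
Local Notation S := {mpoly K[m + n]}.
Local Notation yv := (@yvar K m n).
Variables (M : lmodType S) (G : int * int -> M -> Prop).
Hypothesis hG : bigrading G.

(** Degrees may repeat in the list, so that decompositions are added by concatenation. *)
Definition homog_terms (l : seq ((int * int) * M)) : Prop :=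
  forall x, x \in l -> G x.1 x.2.

Lemma bigr_osub d : osub (fun _ : S => False) (G d).
Proof. by split=> //; [apply: (bigr0 hG)|move=> u v; apply: (bigrB hG)]. Qed.

Lemma homog_dec v : exists2 l, homog_terms l & v = \sum_(x <- l) x.2.
Proof.
have [s [h [hh ->]]] := bigr_dec hG v; exists [seq (d, h d) | d <- s].
  by move=> _ /mapP[d _ ->]; apply: hh.
by rewrite big_map.
Qed.

Lemma homog_indep l (D : pred (int * int)) : homog_terms l ->
  \sum_(x <- l) x.2 = 0 -> \sum_(x <- l | D x.1) x.2 = 0.
Proof.
move=> hl l0; pose s := undup [seq x.1 | x <- l].
pose h d := \sum_(x <- l | x.1 == d) x.2.
have sumE (D' : pred (int * int)) :
    \sum_(x <- l | D' x.1) x.2 = \sum_(d <- s | D' d) h d.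
  rewrite /h (exchange_big_dep (fun x => D' x.1)) /=; last first.
    by move=> d x Dd /eqP ->.
  rewrite big_seq_cond [RHS]big_seq_cond; apply: eq_bigr => x /andP[xl Dx].
  rewrite big_mkcond (bigD1_seq x.1) ?undup_uniq ?mem_undup ?map_f //=.
  rewrite Dx eqxx big1 ?addr0 // => d; rewrite eq_sym => /negPf ->.
  by rewrite andbF.
rewrite sumE big1_seq // => d /andP[_ ds].
apply: (bigr_indep hG (undup_uniq _)) ds.
  by move=> d'; apply: (osub_sum_in (bigr_osub d')) => x xl /eqP <-; apply: hl.
by have /= <- := sumE predT.
Qed.

Definition lo (a : int) (v : M) : M :=
  \sum_(x <- s2val (cid2 (homog_dec v)) | x.1.1 <= a) x.2.

Lemma homog_terms_cat l l' :
  homog_terms l -> homog_terms l' -> homog_terms (l ++ l').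
Proof. by move=> hl hl' x; rewrite mem_cat => /orP[/hl|/hl']. Qed.

Lemma homog_terms_opp l :
  homog_terms l -> homog_terms [seq (x.1, - x.2) | x <- l].
Proof.
by move=> hl _ /mapP[x xl ->]; apply: (osubN (bigr_osub x.1)); apply: hl.
Qed.

(** The difference of two decompositions of [v] is a relation, and its terms of [x]-degree at most
    [a] cancel among themselves. *)
Lemma loE a v l : homog_terms l -> v = \sum_(x <- l) x.2 ->
  lo a v = \sum_(x <- l | x.1.1 <= a) x.2.
Proof.
move=> hl vE; rewrite /lo; case: cid2 => l' /= hl' vE'.
apply/eqP; rewrite -subr_eq0; apply/eqP.
have := @homog_indep (l' ++ [seq (x.1, - x.2) | x <- l]) (fun d => d.1 <= a).
rewrite !big_cat !big_map /= !sumrN; apply; last by rewrite -vE -vE' subrr.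
exact/homog_terms_cat/homog_terms_opp.
Qed.

Lemma loD a u v : lo a (u + v) = lo a u + lo a v.
Proof.
have [l hl uE] := homog_dec u; have [l' hl' vE] := homog_dec v.
rewrite (loE a hl uE) (loE a hl' vE) -big_cat; apply: loE.
  exact: homog_terms_cat.
by rewrite big_cat /= -uE -vE.
Qed.

Lemma lo0 a : lo a 0 = 0.
Proof. by rewrite (@loE a 0 [::]) ?big_nil. Qed.

Lemma loZ (p : S) a b c v : bihomog a b p -> lo c (p *: v) = p *: lo (c - a%:Z) v.
Proof.
move=> hp; have [l hl vE] := homog_dec v; rewrite (loE _ hl vE).
rewrite (@loE _ _ [seq ((x.1.1 + a%:Z, x.1.2 + b%:Z), p *: x.2) | x <- l]).
- rewrite big_map scaler_sumr; apply: eq_bigl => -[[x1 x2] w] /=.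
  by apply/idP/idP; lia.
- by move=> _ /mapP[x xl ->]; apply: (bigrZ hG) => //; apply: hl.
- by rewrite vE scaler_sumr big_map.
Qed.

Lemma loN a v : lo a (- v) = - lo a v.
Proof. by apply: (@addrI _ (lo a v)); rewrite -loD !subrr lo0. Qed.

Lemma loB a u v : lo a (u - v) = lo a u - lo a v.
Proof. by rewrite loD loN. Qed.

Lemma lo_lo a b v : a <= b -> lo a (lo b v) = lo a v.
Proof.
move=> ab; have [l hl vE] := homog_dec v; rewrite (loE b hl vE) (loE a hl vE).
rewrite (@loE _ _ [seq x <- l | x.1.1 <= b]).
- rewrite big_filter_cond; apply: eq_bigl => -[[x1 x2] w] /=.
  by apply/andP/idP => [[]//|xa]; split=> //; lia.
- by move=> x; rewrite mem_filter => /andP[_]; apply: hl.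
- by rewrite big_filter.
Qed.

Lemma lo_bound v : exists N : nat, forall a : int,
  (N%:Z <= a -> lo a v = v) /\ (a < - N%:Z -> lo a v = 0).
Proof.
have [l hl vE] := homog_dec v.
have [N NP] : exists N : nat, forall x, x \in l -> - N%:Z <= x.1.1 <= N%:Z.
  elim: l {hl vE} => [|[[x1 x2] w] l [N NP]]; first by exists 0%N.
  exists (N + `|x1|)%N => -[[z1 z2] w'].
  by rewrite in_cons => /predU1P[[-> _ _]|/NP] /=; lia.
exists N => a; rewrite (loE a hl vE) [in X in _ -> _ = X]vE; split=> aN.
  rewrite big_seq_cond [RHS]big_seq; apply: eq_bigl => -[[x1 x2] w].
  by case xl: (_ \in l) => //=; have /= := NP _ xl; lia.
by rewrite big_seq_cond big1 // => -[[x1 x2] w] /andP[/NP /=]; lia.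
Qed.

(** Multiplication by polynomials never lowers the [x]-degree. *)
Lemma lo_kill_submod a : submod (fun v => lo a v = 0).
Proof.
have hB b : osub (fun _ : S => False) (fun v => lo b v = 0).
  by split=> //; [apply: lo0|move=> u v hu hv; rewrite loB hu hv subrr].
split=> [|u v hu hv|p u _ hu]; [exact: lo0|exact: (osubB (hB a))|].
elim/mpoly_ring_ind: p u hu => [c|i|p q hp hq|p q hp hq] u hu.
- by rewrite (loZ _ _ (@bihomogC K m n c)) subr0 hu scaler0.
- have /loZ -> := @bihomogX K m n U_(i)%MM.
  by rewrite -(lo_lo _ (b := a)) ?hu ?lo0 ?scaler0 //; lia.
- by rewrite scalerDl loD hp // hq // addr0.
- by rewrite -scalerA hp // hq.
Qed.

(** The part of [x]-degree at most [a], realized as a quotient so that it is an [S]-module;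
    [loq_lift] embeds it in [M] as a direct summand over [K[y]]. *)
Definition loq (a : int) : lmodType S := qmod (Submodule (lo_kill_submod a)).
Definition to_loq (a : int) : {linear M -> loq a} := to_qmod (Submodule (lo_kill_submod a)).
Definition loq_lift (a : int) (x : loq a) : M := lo a (repr x).

Lemma to_loqW a x : exists v, to_loq a v = x.
Proof. by have [v ->] := to_qmodW x; exists v. Qed.

Lemma to_loq_eq0 a v : to_loq a v = 0 <-> lo a v = 0.
Proof. exact: to_qmod_eq0. Qed.

Lemma loq_liftE a v : loq_lift (to_loq a v) = lo a v.
Proof.
apply/eqP; rewrite -subr_eq0 -loB; apply/eqP.
suff /to_qmodP : to_qmod (Submodule (lo_kill_submod a)) (repr (to_loq a v)) =
  to_loq a v by [].
exact: reprK.
Qed.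

Lemma loq_liftK a : cancel (@loq_lift a) (to_loq a).
Proof.
move=> x; have [v <-] := to_loqW x; rewrite loq_liftE.
apply/eqP; rewrite -subr_eq0 -linearB; apply/eqP/to_loq_eq0.
by rewrite loB lo_lo // subrr.
Qed.

Lemma loq_lift_ysl a : ysemilinear yv (@loq_lift a).
Proof.
split=> [x x'|j x].
  have [v <-] := to_loqW x; have [v' <-] := to_loqW x'.
  by rewrite -linearD !loq_liftE loD.
have [v <-] := to_loqW x.
by rewrite -linearZ !loq_liftE (loZ _ _ (@bihomog_y K m n j)) subr0.
Qed.

Lemma ygenerates_loq : fin_gen M ->
  exists a : int, ygenerates (@loq_lift a) /\ xnil (loq a).
Proof.
move=> [r [g gP]]; have [N NP] := choice (fun i => lo_bound (g i)).
pose b := (\max_i N i)%N; have Nb i : (N i <= b)%N by apply: leq_bigmax.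
exists b%:Z; split.
  split=> [|c x|L hL Ls v]; first exact: loq_lift_ysl.
    have [v <-] := to_loqW x.
    by rewrite -linearZ !loq_liftE (loZ _ _ (@bihomogC K m n c)) subr0.
  have [p ->] := gP v; apply: (osub_sum hL) => i _; apply: (submodZ hL).
  have <- : loq_lift (to_loq b%:Z (g i)) = g i; last exact: Ls.
  by rewrite loq_liftE; apply: (NP i _).1; have := Nb i; lia.
pose LB (c : int) (v : M) := forall a, a < c -> lo a v = 0.
have LB0 v : LB (- b%:Z) v.
  move=> a ab; have [p ->] := gP v; apply: (osub_sum (lo_kill_submod a)) => i _.
  apply: (submodZ (lo_kill_submod a)); apply: (NP i _).2; have := Nb i; lia.
(* The [x]-degrees that survive in the truncation lie between [-b] and [b], so this many
   multiplications by [x]-variables leave nothing. *)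
exists (b + b).+1 => x; have [v <-] := to_loqW x.
have {LB0} : LB (b%:Z + 1 - (b + b).+1%:Z) v by move=> a ab; apply: LB0; lia.
elim: (b + b).+1 v => [|k IH] v vk /=.
  by apply/to_loq_eq0; apply: vk; lia.
move=> i; rewrite -linearZ; apply: IH => a ak.
by rewrite (loZ _ _ (@bihomog_x K m n i)) vk ?scaler0 //; lia.
Qed.

Lemma bigrading_quotz (t : K) : bigrading (quotz_grading (z := ylin m n t) G).
Proof.
set z := ylin m n t; split.
- by move=> d; exists 0; [apply: (bigr0 hG)|rewrite linear0].
- move=> d _ _ [v Gv ->] [w Gw ->]; exists (v - w); first exact: (bigrB hG).
  by rewrite linearB.
- move=> a b d p _ hp [v Gv ->]; exists (p *: v); first exact: (bigrZ hG).
  by rewrite linearZ.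
- move=> x; have [v <-] := to_quotzW x; have [s [h [hh ->]]] := bigr_dec hG v.
  exists s, (fun d => to_quotz z (h d)); split; last by rewrite linear_sum.
  by move=> d; exists (h d).
move=> s h us hh h0 d ds.
have [v vP] := choice (fun d => let: ex_intro2 v Gv hv := hh d in
  ex_intro (fun v => G d v /\ h d = to_quotz z v) v (conj Gv hv)).
have [|u uE] := (to_quotz_eq0 z (\sum_(d <- s) v d)).1.
  by rewrite linear_sum -[RHS]h0; apply: eq_bigr => d' _; rewrite (vP d').2.
have [l hl lE] := homog_dec u.
(* The relation between the lifts [v d] and [z *: u] is expanded in [M], with the terms of [z *: u]
   shifted by [(0, 1)]. Its component of degree [d] exhibits [v d] as a multiple of [z]. *)
have := @homog_indep ([seq (d, v d) | d <- s] ++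
  [seq (x.1, - x.2) | x <- [seq ((x.1.1 + 0%:Z, x.1.2 + 1%:Z), z *: x.2) | x <- l]])
  (pred1 d).
rewrite !big_cat !big_map /= !sumrN uE -scaler_sumr -lE subrr.
rewrite -big_filter (_ : [seq i <- s | _] = [:: d]); last first.
  exact: filter_pred1_uniq.
rewrite big_seq1 (vP d).2 -scaler_sumr => vd; apply/to_quotz_eq0.
eexists; apply/eqP; rewrite -subr_eq0; apply/eqP/vd => //.
apply: homog_terms_cat; first by move=> _ /mapP[d' _ ->]; case: (vP d').
apply: homog_terms_opp => _ /mapP[x xl ->].
by apply: (bigrZ hG); [exact: bihomog_ylin|exact: hl].
Qed.

End Truncation.

(** * Choice of the linear form and cohomology of the quotient *)

Lemma lc_zero_trivial (R : comNzRingType) (n : nat) (y : 'I_n -> R)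
    (M : lmodType R) i : (forall v : M, v = 0) -> lc_zero M y i.
Proof.
move=> M0 c _; suff -> : c = 0 by apply: osub0 (coboundary_submod M y i).
have [v [k ->]] := cech_frc c; apply: cechP => s.
by rewrite /frc (M0 (v s)) frac0.
Qed.

Theorem lemma4p2 (K : fieldType) (m n : nat) (M : lmodType {mpoly K[m + n]})
    (G : int * int -> M -> Prop) (q : nat) :
  infinite_set [set: K] ->
  rel_CM G -> is_rdim M q -> (0 < q)%N ->
  exists z : {mpoly K[m + n]},
    [/\ bihomogeneous z, in_Q z, regular_on M z,
        rel_CM (quotz_grading (z := z) G) & is_rdim (quotz M z) (q - 1)%N].
Proof.
(* From here on [rdim(Q, M)] is [q.+1], and [q] is the value to be reached. *)
case: q => [|q] // infK [hG fM _ _] [Mq M0] _; rewrite subSS subn0.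
have [a [gs nW]] := ygenerates_loq hG fM.
set W := loq hG a in gs nW.
have fW : fin_gen W := fin_gen_surj (g := to_loq hG a) (@to_loqW _ _ _ _ _ hG a) fM.
have W0 i : (q.+1 < i)%N -> lc_zero W (@yvar K m n) i.
  move=> qi; apply: (@lc_zero_retract _ n (@yvar K m n) M W _ (to_loq hG a) i
    (loq_lift_ysl hG a) (linear_ysl _ (to_loq hG a)) (@loq_liftK _ _ _ _ _ hG a)).
  by apply: M0 => e; rewrite e ltnn in qi.
have M00 : lc_zero M (@yvar K m n) 0 by apply: M0.
have [|t [tW treg]] := @generic_ex _ (fun t =>
    (forall i, (q < i)%N -> lc_zero (quotz W (ylin m n t)) (@yvar K m n) i) /\
    regular_on M (ylin m n t)) infK.
  apply: genericI; first exact: vanishing_generic_quotient.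
  by apply: torsion_free_generic_regular => //; apply/lc_zero0P.
set z := ylin m n t in tW treg.
have [sigma gs'] := ygenerates_quotz t gs.
have N_above : forall i, (q < i)%N -> lc_zero (quotz M z) (@yvar K m n) i.
  apply: (vanishing_transfer infK (sigma := sigma)) => //.
  - exact: fin_gen_quotz.
  - exact: fin_gen_quotz.
  - exact: (xnil_surj (g := to_quotz z) (@to_quotzW _ _ z)).
(* Otherwise [z] would be injective on [H^(q+1)(M)], where each class is killed by a power of [z],
   and this module would vanish. *)
have N_q : ~ lc_zero (quotz M z) (@yvar K m n) q.
  move=> N0; apply: Mq => c hc; have [N] := cocycle_ylin_torsion t hc.
  elim: N => [|N IHN]; first by rewrite scale1r.
  rewrite exprS -scalerA => /(coboundary_regular treg (@to_quotzW _ _ _)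
    (@to_quotz_eq0 _ _ _) N0) h; apply: IHN; apply: h.
  exact: (submodZ (cocycle_submod _ _ _)).
have N_other i : i <> q -> lc_zero (quotz M z) (@yvar K m n) i.
  case: (ltngtP i q) => // [iq _|/N_above //].
  by apply: regular_quotient_vanishing => //; apply: M0 => e; move: iq; rewrite ?e -?e; lia.
exists z; split.
- by exists 0%N, 1%N; apply: bihomog_ylin.
- by exists (fun j => (t ^+ j)%:MP).
- exact: treg.
- split; [exact: bigrading_quotz|exact: fin_gen_quotz| |by exists q].
  (* [M/zM] is nonzero because its cohomology in degree [q] is. *)
  apply: contrapT => no; apply: N_q; apply: lc_zero_trivial => v.
  by apply: contrapT => v0; apply: no; exists v.
- by split.
Qed.
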